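(* Let $K$ be a field with $\operatorname{char} K\neq 2$, and let $f\in K(z)$ be a rational function of degree $2$ with critical points $\xi_1,\xi_2\in\mathbb{P}^1(\overline{K})$. Let $\delta\in K^{\times}$ be the discriminant of the minimal polynomial of $\xi_1$ over $K$, understood to be $\delta=1$ if $\xi_1\in\mathbb{P}^1(K)$. Fix $x_0\in\mathbb{P}^1(K)$ and let $G_\infty$ be the arboreal Galois group of $f$ over $K$ rooted at $x_0$. Suppose that $\xi_1$ and $\xi_2$ collide at the $\ell$-th iterate for some integer $\ell\geq 2$, i.e. $f^{\ell}(\xi_1)=f^{\ell}(\xi_2)$ but $f^{\ell-1}(\xi_1)\neq f^{\ell-1}(\xi_2)$. Then: (1) there is a labeling of the preimage tree with respect to which $G_\infty$ is a subgroup of $\widetilde{M}_{\ell}$ (i.e. $G_\infty$ is equivariantly isomorphic to a subgroup of $\widetilde{M}_\ell$); (2) $G_\infty$ is (equivariantly) isomorphic to a subgroup of $M_{\ell}$ for some labeling if and only if $\delta$ is a square in $K$.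
   Context: $f^n$ denotes the $n$-th iterate of $f$ and $f^{-n}(y)$ the set of solutions of $f^n(z)=y$ in $\mathbb{P}^1(\overline{K})$. Standing assumption: no critical point of $f$ lies in $\bigcup_{n\ge0}f^{-n}(x_0)$, so $f^{-n}(x_0)$ has $2^n$ elements. Let $K_n=K(f^{-n}(x_0))$, $K_\infty=\bigcup_n K_n$, $G_n=\operatorname{Gal}(K_n/K)$, $G_\infty=\operatorname{Gal}(K_\infty/K)$ (the arboreal Galois group). The disjoint union of the sets $f^{-n}(x_0)$ forms an infinite rooted binary tree $T_\infty$: root $x_0$, level-$n$ nodes the points of $f^{-n}(x_0)$, each $y$ at level $n+1$ joined by an edge to $f(y)$; $G_\infty$ acts on it by tree automorphisms, and $T_n$ denotes the subtree of levels $0,\dots,n$. A labeling of the tree assigns to each node at level $m$ a word in $\{0,1\}^m$ (the root gets the empty word), bijectively on each level, so that the two children of the node labeled $w$ are labeled $w0$ and $w1$. Given a labeling, $\sigma\in\operatorname{Aut}(T_\infty)$, a node $y$ and $m\geq1$: $\sigma$ sends the node labeled $ys_1\dots s_m$ to the node labeled $\sigma(y)t_1\dots t_m$, and $\operatorname{sgn}_m(\sigma,y)\in\{\pm1\}$ is the sign of the permutation $(s_1,\dots,s_m)\mapsto(t_1,\dots,t_m)$ of $\{0,1\}^m$. Define $\widetilde{M}_\ell$ to be the set of $\sigma\in\operatorname{Aut}(T_\infty)$ with $\operatorname{sgn}_\ell(\sigma,y)=\operatorname{sgn}_\ell(\sigma,x_0)$ for every node $y$, and $M_\ell$ the set of $\sigma\in\widetilde{M}_\ell$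 for which this common sign is $+1$ (both depend on the labeling). *)

(* Defs.v *)
From HB Require Import structures.
From mathcomp Require Import all_boot all_order all_algebra all_fingroup.

Set Implicit Arguments.
Unset Strict Implicit.
Unset Printing Implicit Defensive.

Import GRing.Theory.
Local Open Scope ring_scope.

(* The projective line over L; None is the point at infinity. *)
Notation P1 L := (option L).

(* A rational function in lowest terms; the pair is unique up to scaling. *)
Record ratfun (L : fieldType) := RatFun {
  num : {poly L};
  den : {poly L};
  coprime_num_den : coprimep num den }.

Definition degree (L : fieldType) (f : ratfun L) : nat :=
  (maxn (size (num f)) (size (den f))).-1.

(* The point [u : v] of the projective line. *)
Definition proj_pt (L : fieldType) (u v : L) : P1 L :=
  if v == 0 then None else Some (u / v).

Definition rat_eval (L : fieldType) (f : ratfun L) (z : P1 L) : P1 L :=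
  match z with
  | Some a => proj_pt (num f).[a] (den f).[a]
  | None => proj_pt (num f)`_(degree f) (den f)`_(degree f)
  end.

(* The multiplicity of z as a solution of f(w) = f(z): the order of vanishing
   at z of a form of degree (degree f), dehomogenized below as g. *)
Definition ram_index (L : fieldType) (f : ratfun L) (z : P1 L) : nat :=
  let g := match rat_eval f z with
           | Some y => num f - y *: den f
           | None => den f
           end in
  match z with
  | Some a => mup a g
  | None => (degree f - (size g).-1)%N
  end.

Definition is_critical (L : fieldType) (f : ratfun L) (z : P1 L) : Prop :=
  (1 < ram_index f z)%N.

Lemma coprime_map_ratfun (K L : fieldType) (iota : {rmorphism K -> L})
    (f : ratfun K) :
  coprimep (map_poly iota (num f)) (map_poly iota (den f)).
Proof. by rewrite coprimep_map coprime_num_den. Qed.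

Definition map_ratfun (K L : fieldType) (iota : {rmorphism K -> L})
    (f : ratfun K) : ratfun L :=
  RatFun (coprime_map_ratfun iota f).

Definition is_min_poly (K L : fieldType) (iota : {rmorphism K -> L}) (a : L)
    (m : {poly K}) : Prop :=
  [/\ m \is monic, root (map_poly iota m) a &
      forall g : {poly K}, root (map_poly iota g) a -> m %| g].

(* For monic m: the product of the squared differences of its roots. *)
Definition is_discriminant (K L : fieldType) (iota : {rmorphism K -> L})
    (m : {poly K}) (d : K) : Prop :=
  exists2 rs : seq L, map_poly iota m = \prod_(r <- rs) ('X - r%:P) &
    iota d = \prod_(j < size rs) \prod_(i < j) (rs`_i - rs`_j) ^+ 2.

Definition is_pt_discriminant (K L : fieldType) (iota : {rmorphism K -> L})
    (xi : P1 L) (d : K) : Prop :=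
  ((exists x : P1 K, xi = omap iota x) /\ d = 1) \/
  (~ (exists x : P1 K, xi = omap iota x) /\
   exists a m, [/\ xi = Some a, is_min_poly iota a m
                 & is_discriminant iota m d]).

(* Nodes carry their level, since a point may occur at several levels. *)
Definition node (L : fieldType) (F : P1 L -> P1 L) (x : P1 L) : Type :=
  {u : nat * P1 L | iter u.1 F u.2 == x}.

Definition level (L : fieldType) (F : P1 L -> P1 L) (x : P1 L)
    (u : node F x) : nat := (val u).1.

Definition point (L : fieldType) (F : P1 L -> P1 L) (x : P1 L)
    (u : node F x) : P1 L := (val u).2.

Definition tree_root (L : fieldType) (F : P1 L -> P1 L) (x : P1 L) :
    node F x :=
  exist (fun u : nat * P1 L => iter u.1 F u.2 == x) (0%N, x) (eqxx x).

(* v is a child of u *)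
Definition edge (L : fieldType) (F : P1 L -> P1 L) (x : P1 L)
    (u v : node F x) : Prop :=
  level v = (level u).+1 /\ F (point v) = point u.

Definition is_tree_aut (L : fieldType) (F : P1 L -> P1 L) (x : P1 L)
    (sigma : node F x -> node F x) : Prop :=
  [/\ bijective sigma, sigma (tree_root F x) = tree_root F x &
      forall u v, edge (sigma u) (sigma v) <-> edge u v].

(* The letters 0 and 1 are false and true. *)
Definition is_labeling (L : fieldType) (F : P1 L -> P1 L) (x : P1 L)
    (lab : node F x -> seq bool) : Prop :=
  [/\ forall u, size (lab u) = level u,
      bijective lab &
      forall u v, edge u v -> exists b : bool, lab v = rcons (lab u) b].

(* is_sgn lab m sigma y e: the sign sgn_m(sigma, y) is e. The permutation pi is
   determined by sigma and y when lab is a labeling. *)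
Definition is_sgn (L : fieldType) (F : P1 L -> P1 L) (x : P1 L)
    (lab : node F x -> seq bool) (m : nat) (sigma : node F x -> node F x)
    (y : node F x) (e : int) : Prop :=
  exists2 pi : {perm m.-tuple bool},
    forall (v : node F x) (s : m.-tuple bool),
      lab v = lab y ++ s -> lab (sigma v) = lab (sigma y) ++ pi s &
    e = (-1) ^+ odd_perm pi.

Definition Mtilde (L : fieldType) (F : P1 L -> P1 L) (x : P1 L)
    (lab : node F x -> seq bool) (l : nat) (sigma : node F x -> node F x) :
    Prop :=
  is_tree_aut sigma /\
  exists2 e : int, is_sgn lab l sigma (tree_root F x) e &
    forall y, is_sgn lab l sigma y e.

Definition M (L : fieldType) (F : P1 L -> P1 L) (x : P1 L)
    (lab : node F x -> seq bool) (l : nat) (sigma : node F x -> node F x) :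
    Prop :=
  Mtilde lab l sigma /\ is_sgn lab l sigma (tree_root F x) 1.

Definition is_subfield (L : fieldType) (E : L -> Prop) : Prop :=
  [/\ E 1, forall a b, E a -> E b -> E (a - b)
    & forall a b, E a -> E b -> E (a / b)].

(* The subfield K(S) of L. *)
Definition adjoin (K L : fieldType) (iota : {rmorphism K -> L}) (S : L -> Prop)
    (a : L) : Prop :=
  forall E : L -> Prop, is_subfield E -> (forall c, E (iota c)) ->
    (forall b, S b -> E b) -> E a.

(* The point at infinity, if it lies in a fibre, contributes no generator. *)
Definition K_level (K L : fieldType) (iota : {rmorphism K -> L})
    (F : P1 L -> P1 L) (x : P1 L) (n : nat) : L -> Prop :=
  adjoin iota (fun b => iter n F (Some b) = x).

Definition K_infty (K L : fieldType) (iota : {rmorphism K -> L})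
    (F : P1 L -> P1 L) (x : P1 L) (a : L) : Prop :=
  exists n, K_level iota F x n a.

(* s restricts to an element of Gal(E / K); values of s outside E are ignored.
   Injectivity on E is automatic. *)
Definition is_gal (K L : fieldType) (iota : {rmorphism K -> L}) (E : L -> Prop)
    (s : L -> L) : Prop :=
  [/\ forall a, E a -> E (s a),
      forall b, E b -> exists2 a, E a & s a = b,
      forall a b, E a -> E b -> s (a + b) = s a + s b,
      forall a b, E a -> E b -> s (a * b) = s a * s b
    & forall c, s (iota c) = iota c].

(* The Galois group of K_infty over K is isomorphic, by phi and compatibly with
   the Galois action on the points of the tree, to a subgroup of the group Mx
   of tree automorphisms. *)
Definition equivariantly_embeds (K L : fieldType) (iota : {rmorphism K -> L})
    (F : P1 L -> P1 L) (x : P1 L) (Mx : (node F x -> node F x) -> Prop) :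
    Prop :=
  let G := is_gal iota (K_infty iota F x) in
  exists phi : (L -> L) -> (node F x -> node F x),
    [/\ forall s, G s -> Mx (phi s),
        forall s u, G s ->
          level (phi s u) = level u /\ point (phi s u) = omap s (point u),
        forall s t, G s -> G t -> phi (s \o t) =1 phi s \o phi t
      & forall s t, G s -> G t -> phi s =1 phi t ->
          forall a, K_infty iota F x a -> s a = t a].

(* Main.v *)
From HB Require Import structures.
From mathcomp Require Import all_boot all_order all_algebra all_fingroup.
From mathcomp Require Import ring boolp classical_sets.
Require Import Defs.

Set Implicit Arguments.
Unset Strict Implicit.
Unset Printing Implicit Defensive.

Import GRing.Theory.
Local Open Scope ring_scope.

(** A quadratic map [f] with critical points [xi1], [xi2] is [z |-> z^2] up to
    changes of coordinates in the source and in the target: in a coordinate [t]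
    with divisor [xi1 - xi2], the fibres of [f] are the pairs [{t, -t}]. The
    sign of a tree automorphism on the [l] levels above [y] is the product of
    its signs at the vertices of [f^-(l-1)(y)], so it is governed by the product
    [P(y)] of [t] over the children labelled 0 of these vertices. The square of
    [P(y)] is the norm along [f^(l-1)] of a function with divisor
    [f(xi1) - f(xi2)]; its divisor [f^l(xi1) - f^l(xi2)] vanishes at a
    collision, so it is a constant [gamma^2], and one can label the tree so that
    [P(y) = gamma] for every [y]. Computing [gamma] with homogeneous lifts of
    [f^(l-1)(xi1)] and [f^(l-1)(xi2)] shows that [tau] fixes [gamma] if it fixes
    the critical points, and maps [gamma] to [-1/gamma] and [t] to [1/t] if it
    exchanges them. Hence all signs of [tau] are [1] in the first case and [-1]
    in the second one, and they are all [1] for every [tau] exactly when [xi1]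
    is rational. Galois elements of the infinite extension are extended to the
    algebraic closure by Zorn's lemma. *)

(** * Extension of homomorphisms to the algebraic closure *)

Section Adjunction.

Variables (E : fieldType) (L : closedFieldType) (i j : {rmorphism E -> L}).

(** A nonzero [m] of least degree killing [x] divides every polynomial killing [x], so any root of
    its image under [j] serves as [y]. *)
Lemma conjugate_root (x : L) : algebraicOver i x ->
  exists y, forall p : {poly E}, root (map_poly i p) x -> root (map_poly j p) y.
Proof.
case=> p0 p0N0 p0x.
pose S n := `[< exists p : {poly E}, [/\ p != 0, root (map_poly i p) x
                                       & size p = n] >].
have exS : exists n, S n by exists (size p0); apply/asboolP; exists p0.
case: (ex_minnP exS) => n /asboolP[m [mN0 mx szm]] min_n.
have szm1 : size (map_poly j m) != 1%N.
  rewrite size_map_poly; apply/negP => /size_poly1P[c cN0 mE].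
  by move: mx; rewrite mE map_polyC rootC fmorph_eq0 (negPf cN0).
have [y my] := closed_rootP _ szm1; exists y => p px.
suff : m %| p by case/dvdpP => q ->; rewrite rmorphM rootM my orbT.
apply: contraT => npm.
have : S (size (p %% m)).
  apply/asboolP; exists (p %% m); split=> //.
  move: px; rewrite [p in map_poly i p](divp_eq p m) rmorphD rmorphM /root.
  by rewrite hornerD hornerM (rootP mx) mulr0 add0r.
by move/min_n; rewrite leqNgt -szm ltn_modp mN0.
Qed.

End Adjunction.

Section Extension.

Variables (K : fieldType) (L : closedFieldType) (iota : {rmorphism K -> L}).
Hypothesis algL : forall a : L, algebraicOver iota a.

Local Open Scope classical_set_scope.

(* The graph of a K-algebra homomorphism from a subring of L to L. *)
Definition hom_graph (G : set (L * L)) : Prop :=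
  [/\ forall c, G (iota c, iota c),
      forall u v, G u -> G v -> G (u.1 - v.1, u.2 - v.2),
      forall u v, G u -> G v -> G (u.1 * v.1, u.2 * v.2)
    & forall b, G (0, b) -> b = 0].

Lemma hom_graph_fun (G : set (L * L)) : hom_graph G ->
  forall a b b', G (a, b) -> G (a, b') -> b = b'.
Proof.
case=> _ GB _ G0 a b b' Gb Gb'; apply/eqP; rewrite -subr_eq0; apply/eqP/G0.
by rewrite -(subrr a); apply: GB Gb Gb'.
Qed.

(** Removing factors ['X] from an equation of [u] leaves [p(u) u + c = 0] with [c] nonzero, whence
    [u^-1 = - p(u) / c]. This makes the domain of a [hom_graph] a field although only ring
    operations are assumed. *)
Lemma algebraic_inv_horner (u : L) : u != 0 ->
  exists q : {poly K}, (map_poly iota q).[u] = u^-1.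
Proof.
move=> uN0; have [p pN0 pu] := algL u; elim/poly_ind: p pN0 pu.
  by rewrite eqxx.
move=> p c IHp; rewrite rmorphD rmorphM /= map_polyX map_polyC /root.
rewrite !hornerE /= => pN0 pu; have [c0|cN0] := eqVneq c 0.
  apply: IHp; last by move: pu; rewrite c0 rmorph0 addr0 mulf_eq0 (negPf uN0) orbF.
  by apply: contra_neq pN0 => ->; rewrite c0 mul0r add0r.
exists (- c^-1 *: p); rewrite linearZ /= hornerZ.
apply: (mulIf uN0); rewrite -mulrA mulVf //.
rewrite (eqP (_ : (map_poly iota p).[u] * u == - iota c)) -?addr_eq0 //.
by rewrite rmorphN fmorphV mulrNN mulVf ?fmorph_eq0.
Qed.

Lemma hom_graph_horner (G : set (L * L)) : hom_graph G ->
  forall (p : {poly K}) u, G u ->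
    G ((map_poly iota p).[u.1], (map_poly iota p).[u.2]).
Proof.
case=> GK GB GM _ p u Gu.
have G00 : G (0, 0) by rewrite -(rmorph0 iota).
have GD v w : G v -> G w -> G (v.1 + w.1, v.2 + w.2).
  move=> Gv Gw; have /= := GB _ _ Gv (GB _ _ G00 Gw).
  by rewrite !sub0r !opprK.
elim/poly_ind: p => [|p c IHp]; first by rewrite rmorph0 !horner0.
rewrite rmorphD rmorphM /= map_polyX map_polyC !hornerE /=.
by apply: (GD (_ , _) (_ , _)) => //; apply: (GM (_ , _)).
Qed.

Section Domain.

Variables (G : set (L * L)) (Ghom : hom_graph G).

Definition graph_dom : {pred L} := fun a => `[< exists b, G (a, b) >].

Lemma graph_domP a : reflect (exists b, G (a, b)) (a \in graph_dom).
Proof. exact: asboolP. Qed.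

Lemma graph_dom_divring : divring_closed graph_dom.
Proof.
have [GK GB GM _] := Ghom; split.
- by apply/graph_domP; exists 1; rewrite -(rmorph1 iota).
- move=> a b /graph_domP[a' Ga] /graph_domP[b' Gb]; apply/graph_domP.
  by exists (a' - b'); apply: (GB _ _ Ga Gb).
move=> a b /graph_domP[a' Ga] /graph_domP[b' Gb]; apply/graph_domP.
have [->|bN0] := eqVneq b 0.
  by exists (iota 0); rewrite invr0 mulr0 -{1}(rmorph0 iota).
have [q qb] := algebraic_inv_horner bN0.
have Gq := hom_graph_horner Ghom q Gb; rewrite /= qb in Gq.
by exists (a' * (map_poly iota q).[b']); apply: (GM _ _ Ga Gq).
Qed.

HB.instance Definition _ :=
  GRing.isDivringClosed.Build L graph_dom graph_dom_divring.

(** The domain becomes a field type so that [conjugate_root] applies to polynomials over it, with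
    the inclusion and [graph_map] as the two embeddings. *)
Record graph_field := GraphField { gval : L; gvalP : gval \in graph_dom }.

HB.instance Definition _ := [isSub for gval].
HB.instance Definition _ := [Choice of graph_field by <:].
HB.instance Definition _ := [SubChoice_isSubIntegralDomain of graph_field by <:].
HB.instance Definition _ := [SubIntegralDomain_isSubField of graph_field by <:].


Definition graph_map (a : graph_field) : L :=
  xget 0 [set b | G (gval a, b)].

Lemma graph_mapP a : G (gval a, graph_map a).
Proof. by have /graph_domP/(xgetPex 0) := gvalP a. Qed.

Lemma graph_mapE a b : G (gval a, b) -> graph_map a = b.
Proof. exact: (hom_graph_fun Ghom (graph_mapP a)). Qed.

Lemma graph_map_zmod : zmod_morphism graph_map.
Proof.
have [_ GB _ _] := Ghom; move=> a b; apply: graph_mapE.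
exact: (GB _ _ (graph_mapP a) (graph_mapP b)).
Qed.

Lemma graph_map_monoid : monoid_morphism graph_map.
Proof.
have [GK _ GM _] := Ghom; split.
  by apply: graph_mapE; have := GK 1; rewrite rmorph1.
move=> a b; apply: graph_mapE.
exact: (GM _ _ (graph_mapP a) (graph_mapP b)).
Qed.

HB.instance Definition _ :=
  GRing.isZmodMorphism.Build graph_field L graph_map graph_map_zmod.
HB.instance Definition _ :=
  GRing.isMonoidMorphism.Build graph_field L graph_map graph_map_monoid.

(** The element [x] is sent to a conjugate [y]: the pairs of values of [p] at [x] and of its
    transport by [graph_map] at [y] form a graph, because the second value vanishes with the
    first. *)
Lemma hom_graph_extend (x : L) :
  exists2 G', hom_graph G' & G `<=` G' /\ exists y, G' (x, y).
Proof.
have [GK GB GM G0] := Ghom.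
pose i : {rmorphism graph_field -> L} := val.
pose j : {rmorphism graph_field -> L} := graph_map.
have inG u : G u -> exists2 a, i a = u.1 & j a = u.2.
  case: u => u v Guv; have uG : u \in graph_dom by apply/graph_domP; exists v.
  by exists (GraphField uG) => //=; apply: graph_mapE.
have algx : algebraicOver i x.
  have [p pN0 px] := algL x.
  have GKd c : iota c \in graph_dom by apply/graph_domP; exists (iota c).
  have kE : map_poly i (map_poly (fun c => GraphField (GKd c)) p) = map_poly iota p.
    apply/polyP => k; rewrite coef_map !coef_map_id0 ?rmorph0 //.
    by apply: val_inj; rewrite /= rmorph0.
  exists (map_poly (fun c => GraphField (GKd c)) p); last by rewrite kE.
  by rewrite -(map_poly_eq0 i) kE map_poly_eq0.
have [y xy] := conjugate_root j algx.
pose ev (p : {poly graph_field}) := ((map_poly i p).[x], (map_poly j p).[y]).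
have evC a : ev a%:P = (i a, j a) by rewrite /ev !map_polyC !hornerC.
exists (range ev); split.
- move=> c; have [a ia ja] := inG _ (GK c).
  by exists a%:P; rewrite // evC ia ja.
- by move=> _ _ [p _ <-] [q _ <-]; exists (p - q); rewrite // /ev !rmorphB !hornerE.
- by move=> _ _ [p _ <-] [q _ <-]; exists (p * q); rewrite // /ev !rmorphM !hornerE.
- by move=> b [p _ [/eqP/xy/rootP py <-]].
- move=> u /inG[a ia ja].
  by exists a%:P; rewrite // evC ia ja -surjective_pairing.
- by exists y, 'X => //; rewrite /ev !map_polyX !hornerX.
Qed.

End Domain.

Theorem hom_graph_rmorphism (G : set (L * L)) : hom_graph G ->
  exists tau : {rmorphism L -> L}, forall u, G u -> tau u.1 = u.2.
Proof.
move=> Ghom.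
(* Zorn's lemma is applied to the sets whose union with [G] is a graph, so that the empty chain is
   covered as well. *)
have [|H [Hhom Hmax]] := @Zorn_bigcup _ [set X | hom_graph (X `|` G)].
  move=> F FP Ftot /=.
  have [FN0|F0] := pselect (exists X, F X); last first.
    rewrite bigcup0 ?set0U // => X FX; by case: F0; exists X.
  have mem u : (\bigcup_(X in F) X `|` G) u -> exists2 X, F X & (X `|` G) u.
    case=> [[X FX Xu]|Gu]; first by exists X => //; left.
    by case: FN0 => X FX; exists X => //; right.
  have sub X : F X -> X `|` G `<=` \bigcup_(X in F) X `|` G.
    by move=> FX; apply: setSU; apply: bigcup_sup.
  have mem2 u v : (\bigcup_(X in F) X `|` G) u -> (\bigcup_(X in F) X `|` G) v ->
      exists X, [/\ F X, (X `|` G) u & (X `|` G) v].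
    move=> /mem[X FX Xu] /mem[Y FY Yv].
    have [XY|YX] := Ftot _ _ FX FY; [exists Y | exists X]; split=> //.
      exact: setSU XY _ Xu.
    exact: setSU YX _ Yv.
  split.
  - by move=> c; right; case: Ghom.
  - move=> u v Uu /(mem2 _ _ Uu)[X [FX Xu Xv]]; apply: (sub X FX).
    by have [_ GB _ _] := FP _ FX; apply: GB.
  - move=> u v Uu /(mem2 _ _ Uu)[X [FX Xu Xv]]; apply: (sub X FX).
    by have [_ _ GM _] := FP _ FX; apply: GM.
  - by move=> b /mem[X FX Xb]; have [_ _ _] := FP _ FX; apply.
rewrite /= in Hhom.
(* A maximal graph is defined everywhere, since [hom_graph_extend] would otherwise enlarge it. *)
have full x : exists y, (H `|` G) (x, y).
  have [H' H'hom [sHH' [y H'y]]] := hom_graph_extend Hhom x.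
  exists y; apply: contrapT => nHy; apply: (Hmax H').
    split; last by move=> sH'H; apply: nHy; left; apply: sH'H.
    exact: subset_trans (@subsetUl _ _ _) sHH'.
  by rewrite /= setUidl //; apply: subset_trans (@subsetUr _ _ _) sHH'.
pose t x := sval (cid (full x)).
have tP x : (H `|` G) (x, t x) by exact: (proj2_sig (cid (full x))).
have tE x y : (H `|` G) (x, y) -> t x = y by exact: (hom_graph_fun Hhom (tP x)).
have [HK HB HM _] := Hhom.
have tB : zmod_morphism t by move=> x y; apply: tE; apply: (HB _ _ (tP x) (tP y)).
have tM : monoid_morphism t.
  split; first by apply: tE; rewrite -(rmorph1 iota); apply: HK.
  by move=> x y; apply: tE; apply: (HM _ _ (tP x) (tP y)).
pose mB := GRing.isZmodMorphism.Build L L t tB.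
pose mM := GRing.isMonoidMorphism.Build L L t tM.
pose tau : {rmorphism L -> L} := HB.pack t mB mM.
by exists tau => -[a b] Gab /=; apply: tE; right.
Qed.

(** An endomorphism over [K] maps the finite set of roots of a polynomial over [K] injectively into
    itself, hence onto itself. *)
Lemma rmorphism_bij (tau : {rmorphism L -> L}) :
  (forall c, tau (iota c) = iota c) -> bijective tau.
Proof.
move=> tauK; suff surj b : exists a, tau a == b.
  exists (fun b => xchoose (surj b)) => [a|b]; last exact/eqP/(xchooseP (surj b)).
  exact/(fmorph_inj tau)/eqP/(xchooseP (surj (tau a))).
have [p pN0 pb] := algL b.
have [rs rsE] := closed_field_poly_normal (map_poly iota p).
have memrs a : (a \in rs) = root (map_poly iota p) a.
  by rewrite rsE rootZ ?lead_coef_eq0 ?map_poly_eq0 // root_prod_XsubC.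
have taup a : root (map_poly iota p) a -> root (map_poly iota p) (tau a).
  rewrite -(fmorph_root tau) -map_poly_comp.
  by rewrite (eq_map_poly (tauK : tau \o iota =1 iota)).
have sub : {subset map tau (undup rs) <= undup rs}.
  by move=> z /mapP[a + ->]; rewrite !mem_undup !memrs => /taup.
have uq : uniq (map tau (undup rs)).
  by rewrite map_inj_uniq ?undup_uniq //; apply: fmorph_inj.
have [_ eqi] := uniq_min_size uq sub (eq_leq (esym (size_map _ _))).
have : b \in map tau (undup rs) by rewrite eqi mem_undup memrs.
by case/mapP => a _ ->; exists a.
Qed.

End Extension.

(** * Signs of permutations preserving blocks of size two *)

Section WreathSign.

Variables (T X : finType) (h : T * bool -> X) (g : X -> T * bool).
Hypotheses (hK : cancel h g) (gK : cancel g h).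

Let h_inj : injective h := can_inj hK.

(** Composing with the transposition of one flipped pair lowers the number of flipped pairs, so [pi]
    is a product of one transposition per flipped pair. *)
Lemma odd_perm_fibre (pi : {perm X}) (eps : T -> bool) :
  (forall u b, pi (h (u, b)) = h (u, b (+) eps u)) ->
  odd_perm pi = \big[addb/false]_u eps u.
Proof.
have [n] := ubnP #|[pred v | eps v]|.
elim: n => // n IHn in pi eps *; rewrite ltnS => le_n piE.
have [u eps_u|eps0] := pickP eps; last first.
  have -> : pi = 1%g.
    apply/permP => x; rewrite perm1 -(gK x); case: (g x) => u b.
    by rewrite piE eps0 addbF.
  by rewrite odd_perm1 big1.
pose eps' v := eps v && (v != u).
have lt_eps' : (#|[pred v | eps' v]| < n)%N.
  apply: leq_trans le_n; rewrite (cardD1 u [pred v | eps v]) inE eps_u add1n ltnS.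
  by apply: subset_leq_card; apply/fintype.subsetP => v; rewrite !inE /= /eps' andbC.
have := IHn (tperm (h (u, false)) (h (u, true)) * pi)%g eps' lt_eps'.
rewrite odd_permM odd_tperm (inj_eq h_inj) xpair_eqE andbF /=.
rewrite [in X in X -> _](bigD1 u) //= {2}/eps' eqxx andbF addFb.
rewrite (eq_bigr eps) => [IH|v vNu]; last by rewrite /eps' vNu andbT.
rewrite (bigD1 u) //= eps_u -IH ?addTb ?negbK // => v b.
rewrite permM; have [-> | vNu] := eqVneq v u.
  rewrite /eps' eqxx andbF addbF.
  by case: b; rewrite ?tpermL ?tpermR piE eps_u.
by rewrite tpermD ?piE /eps' ?vNu ?andbT // (inj_eq h_inj) xpair_eqE eq_sym
           (negPf vNu).
Qed.

(* Moving the blocks [{h (u, false), h (u, true)}] without flipping them is an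
   even permutation, so only the flips contribute. *)
Lemma odd_perm_wreath (pi : {perm X}) (rho : {perm T}) (eps : T -> bool) :
  (forall u b, pi (h (u, b)) = h (rho u, b (+) eps u)) ->
  odd_perm pi = \big[addb/false]_u eps u.
Proof.
have [ts -> _] := prod_tpermP rho.
elim: ts pi eps => [|[u v] ts IHts] pi eps piE.
  by apply: odd_perm_fibre => w b; rewrite piE big_nil perm1.
have [uv|uNv] := eqVneq u v.
  apply: IHts => w b; rewrite piE big_cons /= uv.
  by rewrite tperm1 mul1g.
(* Exchanging the blocks of [u] and [v] takes two transpositions, [sw false] and [sw true], whose
   signs cancel. *)
pose sw b := tperm (h (u, b)) (h (v, b)).
have swE b w c : sw b (h (w, c)) = h (if b == c then tperm u v w else w, c).
  rewrite /sw; case: eqP => [->|bNc].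
    rewrite !permE /= !(inj_eq h_inj) !xpair_eqE eqxx !andbT.
    by case: (w == u) => //; case: (w == v).
  rewrite tpermD // (inj_eq h_inj) xpair_eqE;
    by move/eqP/negPf: bNc => ->; rewrite andbF.
have := IHts (sw false * sw true * pi)%g (fun w => eps (tperm u v w)).
rewrite !odd_permM !odd_tperm !(inj_eq h_inj) !xpair_eqE (negPf uNv) /= => ->.
  by rewrite [RHS](reindex_inj (@perm_inj _ (tperm u v))).
move=> w b; rewrite !permM !swE.
have -> : (if true == b then tperm u v (if false == b then tperm u v w else w)
  else if false == b then tperm u v w else w) = tperm u v w by case: b.
by rewrite piE big_cons permM /= tpermK.
Qed.

End WreathSign.

Definition rcons_pair (k : nat) (p : k.-tuple bool * bool) : k.+1.-tuple bool :=
  [tuple of rcons p.1 p.2].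

Lemma rcons_pair_bij (k : nat) : bijective (@rcons_pair k).
Proof.
apply: inj_card_bij => [[u b] [v c] /(congr1 val) /= /rcons_inj[uv ->]|].
  by congr (_, _); apply: val_inj.
by rewrite card_prod !card_tuple card_bool expnSr.
Qed.

Lemma odd_perm_rcons (k : nat) (pi : {perm k.+1.-tuple bool})
    (rho : {perm k.-tuple bool}) (eps : k.-tuple bool -> bool) :
  (forall (u : k.-tuple bool) b,
     pi [tuple of rcons u b] = [tuple of rcons (rho u) (b (+) eps u)]) ->
  odd_perm pi = \big[addb/false]_u eps u.
Proof. by have [g hK gK] := rcons_pair_bij k; apply: (odd_perm_wreath hK gK). Qed.

Lemma prod_rcons_tuple (R : comNzRingType) (k : nat) (f : seq bool -> R) :
  \prod_(u : k.+1.-tuple bool) f u =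
  \prod_(u : k.-tuple bool) (f (rcons u true) * f (rcons u false)).
Proof.
rewrite (reindex (@rcons_pair k)) /=; last exact: onW_bij (rcons_pair_bij k).
rewrite -(pair_bigA _ (fun (u : k.-tuple bool) b => f (rcons u b))) /=.
by apply: eq_bigr => u _; rewrite big_bool.
Qed.

(** * Labels from a section *)

Section BinaryTree.

Variables (X : eqType) (F iv : X -> X) (tree : X -> Prop).
Hypothesis tree_preim : forall p, tree (F p) -> tree p.
Hypothesis F_iv : forall p, tree p -> F (iv p) = F p.
Hypothesis iv_neq : forall p, tree p -> iv p != p.
Hypothesis F_fibre : forall p q, tree p -> F q = F p -> q = p \/ q = iv p.

(** A section chooses the child labelled 0 of every point of the tree. It depends on the point
    alone, so a point that occurs at several levels is treated alike at all of them. *)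
Definition is_section (c : X -> X) : Prop := forall y, tree y -> F (c y) = y.

Definition child (c : X -> X) (b : bool) (y : X) : X :=
  if b then iv (c y) else c y.

Definition desc (c : X -> X) (y : X) (u : seq bool) : X :=
  foldl (fun z b => child c b z) y u.

(* The last [n] letters of the label of [p] when [c] selects the children
   labelled 0. *)
Fixpoint label (c : X -> X) (n : nat) (p : X) : seq bool :=
  if n is m.+1 then rcons (label c m (F p)) (p != c (F p)) else [::].

Lemma size_label c n p : size (label c n p) = n.
Proof. by elim: n p => //= n IHn p; rewrite size_rcons IHn. Qed.

Lemma label_add c n k p :
  label c (n + k) p = label c n (iter k F p) ++ label c k p.
Proof.
elim: k p => [|k IHk] p; first by rewrite addn0 cats0.
by rewrite addnS /= IHk rcons_cat -iterSr.
Qed.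

Lemma desc_rcons c y u b : desc c y (rcons u b) = child c b (desc c y u).
Proof. by rewrite /desc -cats1 foldl_cat. Qed.

Lemma desc_cat c y u v : desc c y (u ++ v) = desc c (desc c y u) v.
Proof. exact: foldl_cat. Qed.

Section OneSection.

Variables (c : X -> X) (cP : is_section c).

Lemma tree_section y : tree y -> tree (c y).
Proof. by move=> ty; apply: tree_preim; rewrite cP. Qed.

Lemma F_child b y : tree y -> F (child c b y) = y.
Proof. by move=> ty; case: b => /=; rewrite ?F_iv ?cP //; apply: tree_section. Qed.

Lemma tree_child b y : tree y -> tree (child c b y).
Proof. by move=> ty; apply: tree_preim; rewrite F_child. Qed.

Lemma child_eq b y : tree y -> (child c b y != c y) = b.
Proof.
by move=> ty; case: b; rewrite /= ?eqxx ?(iv_neq (tree_section ty)).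
Qed.

Lemma child_label p : tree (F p) -> child c (p != c (F p)) (F p) = p.
Proof.
move=> tFp; have [->|pN] := eqVneq p (c (F p)).
  by rewrite cP // eqxx.
have [pE|//] := F_fibre (tree_section tFp) (esym (cP tFp)).
by rewrite -pE eqxx in pN.
Qed.

Lemma tree_desc y u : tree y -> tree (desc c y u).
Proof.
move=> ty; elim/last_ind: u => // u b IHu.
by rewrite desc_rcons; apply: tree_child.
Qed.

Lemma iter_desc y u : tree y -> iter (size u) F (desc c y u) = y.
Proof.
move=> ty; elim/last_ind: u => // u b IHu.
by rewrite size_rcons iterSr desc_rcons F_child //; apply: tree_desc.
Qed.

Lemma label_desc y u : tree y -> label c (size u) (desc c y u) = u.
Proof.
move=> ty; elim/last_ind: u => // u b IHu.
rewrite size_rcons desc_rcons /= F_child ?IHu ?child_eq //; exact: tree_desc.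
Qed.

Lemma label_desc_tuple k (u : k.-tuple bool) y :
  tree y -> label c k (desc c y u) = u.
Proof. by move=> ty; rewrite -[RHS](label_desc u ty) size_tuple. Qed.

Lemma iter_desc_tuple k (u : k.-tuple bool) y :
  tree y -> iter k F (desc c y u) = y.
Proof. by move=> ty; rewrite -[RHS](iter_desc u ty) size_tuple. Qed.

Lemma tree_iter n p : tree (iter n F p) -> tree p.
Proof. by elim: n p => // n IHn p; rewrite iterSr => /IHn/tree_preim. Qed.

Lemma desc_label n p : tree (iter n F p) -> desc c (iter n F p) (label c n p) = p.
Proof.
elim: n p => // n IHn p; rewrite iterSr => tp.
by rewrite /= desc_rcons IHn // child_label //; apply: tree_iter tp.
Qed.

End OneSection.

(** * Action of an equivariant injection on labels *)

Section Transport.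

Variables (c c' : X -> X) (cP : is_section c) (c'P : is_section c').
Variables (tau : X -> X).
Hypothesis tau_inj : injective tau.
Hypothesis tauF : forall p, tau (F p) = F (tau p).
Hypothesis tau_tree : forall p, tree p -> tree (tau p).

Lemma tau_iter n p : tau (iter n F p) = iter n F (tau p).
Proof. by elim: n => //= n IHn; rewrite tauF IHn. Qed.

Lemma size_transport k y (u : k.-tuple bool) :
  size (label c' k (tau (desc c y u))) == k.
Proof. by rewrite size_label. Qed.

(** The permutation whose sign is studied. Two sections are allowed so that the identity can compare
    two labelings; a Galois element is used with [c' := c]. *)
Definition transport k y (u : k.-tuple bool) : k.-tuple bool :=
  Tuple (size_transport y u).

Definition flip y (u : seq bool) : bool :=
  tau (c (desc c y u)) != c' (tau (desc c y u)).

Variables (y : X) (ty : tree y).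

Lemma desc_transport k (u : k.-tuple bool) :
  desc c' (tau y) (transport y u) = tau (desc c y u).
Proof.
have it : iter k F (tau (desc c y u)) = tau y.
  by rewrite -tau_iter iter_desc_tuple.
by rewrite -{1}it desc_label // it; apply: tau_tree.
Qed.

Lemma transport_inj k : injective (@transport k y).
Proof.
move=> u v /(congr1 (fun w : k.-tuple bool => desc c' (tau y) w)).
rewrite !desc_transport => /tau_inj /(congr1 (label c k)).
by rewrite !label_desc_tuple // => uv; apply: val_inj.
Qed.

Lemma tau_section (u : seq bool) :
  tau (c (desc c y u)) = child c' (flip y u) (tau (desc c y u)).
Proof.
have td := tree_desc cP u ty.
have Ftc : F (tau (c (desc c y u))) = tau (desc c y u) by rewrite -tauF cP.
by rewrite -[LHS](child_label c'P) ?Ftc //; apply: tau_tree.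
Qed.

(** By injectivity [tau] sends the two children of a vertex to the two distinct children of its
    image, so exactly one of these images is labelled 0. *)
Lemma transport_rcons k (u : k.-tuple bool) b :
  transport y [tuple of rcons u b] =
    [tuple of rcons (transport y u) (b (+) flip y u)].
Proof.
apply: val_inj => /=; have td := tree_desc cP u ty.
rewrite desc_rcons -tauF F_child //; congr rcons.
case: b => /=; rewrite /flip //.
have ttd := tau_tree td.
have [eq_tc|neq_tc] := eqVneq (tau (c (desc c y u))) (c' (tau (desc c y u))).
  rewrite -eq_tc (inj_eq tau_inj); exact: iv_neq (tree_section cP td).
rewrite /=; apply/negbTE; rewrite negbK; apply: contraT => neq_ti.
have tt := tree_section cP td.
have := child_label c'P (p := tau (c (desc c y u))).
rewrite -tauF cP // => /(_ ttd); rewrite neq_tc /= => E1.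
have := child_label c'P (p := tau (iv (c (desc c y u)))).
rewrite -tauF F_iv // cP // => /(_ ttd); rewrite neq_ti /= => E2.
have := iv_neq tt; rewrite -(inj_eq tau_inj) -E1 -E2 eqxx //.
Qed.

Lemma odd_transport k (pi : {perm k.+1.-tuple bool}) :
  pi =1 @transport k.+1 y ->
  odd_perm pi = \big[addb/false]_(u : k.-tuple bool) flip y u.
Proof.
move=> piE; apply: (@odd_perm_rcons _ _ (perm (@transport_inj k))) => u b.
by rewrite piE transport_rcons permE.
Qed.

(** After reindexing by [transport], each flip replaces a value of [t] by its opposite. The sign of
    [tau] on [k.+1] levels is thus read off from two products. *)
Lemma prod_transport (R : comNzRingType) (t : X -> R) k :
  (forall p, tree p -> t (iv p) = - t p) ->
  \prod_(u : k.-tuple bool) t (tau (c (desc c y u))) =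
    (-1) ^+ (\big[addb/false]_(u : k.-tuple bool) flip y u) *
    \prod_(u : k.-tuple bool) t (c' (desc c' (tau y) u)).
Proof.
move=> t_iv.
rewrite (big_morph (fun b : bool => (-1) ^+ b : R) (@signr_addb R)
  (expr0 (-1) : (-1) ^+ false = 1)).
rewrite [X in _ = _ * X](reindex_inj (@transport_inj k)) -big_split /=.
apply: eq_bigr => u _; rewrite desc_transport tau_section.
have ttd := tau_tree (tree_desc cP u ty).
by case: flip; rewrite ?mul1r //= t_iv ?mulN1r //; apply: tree_section.
Qed.

End Transport.

(** * Choosing a labeling with prescribed products *)

Section SignCorrection.

Variables (R : idomainType) (t : X -> R) (gamma : R) (k : nat).
Hypothesis t_iv : forall p, tree p -> t (iv p) = - t p.
Hypothesis t_sqr : forall c y, is_section c -> tree y ->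
  (\prod_(u : k.-tuple bool) t (c (desc c y u))) ^+ 2 = gamma ^+ 2.

(* Exchanging the two children of one vertex of [F^-k(y)] changes the sign of
   the product attached to [y] and of no other one. *)
Lemma signed_section c0 : is_section c0 ->
  exists2 c, is_section c & forall y, tree y ->
    \prod_(u : k.-tuple bool) t (c (desc c y u)) = gamma.
Proof.
move=> c0P.
pose bad y := \prod_(u : k.-tuple bool) t (c0 (desc c0 y u)) != gamma.
(* One distinguished vertex of [F^-k(y)] for each [y]: the only one whose children may be
   exchanged. *)
pose w0 y := desc c0 y [tuple of nseq k false].
pose c w := if (w == w0 (iter k F w)) && bad (iter k F w)
            then iv (c0 w) else c0 w.
have cP : is_section c.
  move=> y ty; rewrite /c; case: ifP => _; rewrite ?F_iv ?c0P //.
  exact: (tree_section c0P).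
exists c => // y ty.
have flipE (u : k.-tuple bool) :
    flip c0 c id y u = (u == [tuple of nseq k false]) && bad y.
  have td := tree_desc c0P u ty.
  have it : iter k F (desc c0 y u) = y by exact: iter_desc_tuple.
  rewrite /flip /c it; have [->|uN] := eqVneq u [tuple of nseq k false].
    rewrite eqxx /=; case: (bad y); rewrite /= ?eqxx // eq_sym.
    exact: iv_neq (tree_section c0P (tree_desc c0P _ ty)).
  rewrite ifF ?eqxx // andbC; apply/negP => /andP[_ /eqP /(congr1 (label c0 k))].
  by rewrite !label_desc_tuple // => /val_inj uE; rewrite uE eqxx in uN.
have flips : \big[addb/false]_(u : k.-tuple bool) flip c0 c id y u = bad y.
  rewrite (bigD1 [tuple of nseq k false]) //= flipE eqxx big1 ?addbF // => u.
  by rewrite flipE => /negPf->.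
(* Transport along the identity compares the products for [c0] and [c], which differ by at most one
   flip; by [t_sqr] the product for [c0] is [gamma] or [- gamma]. *)
have := @prod_transport c0 c c0P cP id (@inj_id _) (fun _ => erefl) (fun _ h => h)
          y ty R t k t_iv.
rewrite flips /bad; have := t_sqr c0P ty.
set P0 := \prod_u t (c0 _) => /eqP; rewrite eqf_sqr.
case: eqP => [-> _|_ /= /eqP ->].
  by rewrite mul1r.
by rewrite mulN1r => /oppr_inj.
Qed.

End SignCorrection.

End BinaryTree.

(** * Homogeneous coordinates *)

Section Wedge.

Variable L : fieldType.
Implicit Types (u v w : L * L) (p q : P1 L) (a : L).

Definition wedge u v : L := u.1 * v.2 - u.2 * v.1.
Definition comb a u (b : L) v : L * L := (a * u.1 + b * v.1, a * u.2 + b * v.2).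
Definition scalev a u : L * L := (a * u.1, a * u.2).
Definition lift p : L * L := if p is Some a then (a, 1) else (1, 0).
Definition mkpt u : P1 L := proj_pt u.1 u.2.

Lemma lift_neq0 p : lift p != (0, 0).
Proof. by case: p => [a|]; rewrite xpair_eqE oner_eq0 ?andbF. Qed.

Lemma lift_mkpt u : u != (0, 0) -> exists2 a, a != 0 & lift (mkpt u) = scalev a u.
Proof.
case: u => x y; rewrite /mkpt /proj_pt xpair_eqE /=.
have [->|yN0 _] := eqVneq y 0.
  rewrite andbT => xN0; exists x^-1; first by rewrite invr_eq0.
  by rewrite /scalev /= mulVf ?mulr0.
by exists y^-1; rewrite ?invr_eq0 // /scalev /= mulVf // mulrC.
Qed.

Lemma wedge_lift_eq0 p q : (wedge (lift p) (lift q) == 0) = (p == q).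
Proof.
case: p q => [a|] [b|]; rewrite /wedge /= ?mulr0 ?mul0r ?mulr1 ?mul1r.
- by rewrite subr_eq0.
- by rewrite sub0r oppr_eq0 oner_eq0.
- by rewrite subr0 oner_eq0.
- by rewrite subrr !eqxx.
Qed.

Lemma wedgeZl a u v : wedge (scalev a u) v = a * wedge u v.
Proof. by rewrite /wedge /=; ring. Qed.

Lemma wedgeZr a u v : wedge u (scalev a v) = a * wedge u v.
Proof. by rewrite /wedge /=; ring. Qed.

End Wedge.

(** * Quadratic forms and critical points *)

Section QuadraticMap.

Variables (L : fieldType) (n d : {poly L}).

Definition qform (p : {poly L}) (u : L * L) : L :=
  p`_2 * u.1 ^+ 2 + p`_1 * u.1 * u.2 + p`_0 * u.2 ^+ 2.

Definition polar (p : {poly L}) (u v : L * L) : L :=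
  2 * p`_2 * u.1 * v.1 + p`_1 * (u.1 * v.2 + u.2 * v.1) + 2 * p`_0 * u.2 * v.2.

Definition qmap u := (qform n u, qform d u).
Definition qpolar u v := (polar n u v, polar d u v).

(** As [qpolar u v] is the derivative of [qmap] at [u] along [v], the condition says that the
    differential of the induced map of the projective line vanishes at [u]. *)
Definition qcrit u := forall v, wedge (qmap u) (qpolar u v) = 0.

Lemma qmapZ a u : qmap (scalev a u) = scalev (a ^+ 2) (qmap u).
Proof. by rewrite /qmap /qform /scalev /=; congr (_, _); ring. Qed.

Lemma qcrit_basis u : wedge (qmap u) (qpolar u (1, 0)) = 0 ->
  wedge (qmap u) (qpolar u (0, 1)) = 0 -> qcrit u.
Proof.
move=> c1 c2 v.
have -> : wedge (qmap u) (qpolar u v) = v.1 * wedge (qmap u) (qpolar u (1, 0))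
    + v.2 * wedge (qmap u) (qpolar u (0, 1)).
  by rewrite /wedge /qpolar /polar /=; ring.
by rewrite c1 c2 !mulr0 addr0.
Qed.

End QuadraticMap.

Section Degree2.

Variables (L : fieldType) (f : ratfun L) (degf : degree f = 2%N).

Notation hom := (qmap (num f) (den f)).

Lemma size_num_den : (size (num f) <= 3)%N /\ (size (den f) <= 3)%N.
Proof.
move: degf; rewrite /degree => h.
have : (maxn (size (num f)) (size (den f)) <= 3)%N.
  by case: maxn h => // m /= ->.
by rewrite geq_max => /andP.
Qed.

Lemma horner_size3 (p : {poly L}) a : (size p <= 3)%N ->
  p.[a] = p`_2 * a ^+ 2 + p`_1 * a + p`_0.
Proof.
by move=> sp; rewrite (horner_coef_wide _ sp) !big_ord_recr big_ord0 /=; ring.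
Qed.

Lemma deriv_horner_size3 (p : {poly L}) a : (size p <= 3)%N ->
  p^`().[a] = 2 * p`_2 * a + p`_1.
Proof.
move=> sp; have sd : (size p^`() <= 3)%N.
  by apply: leq_trans (size_poly _ _) _; case: size sp => // m /ltnW.
rewrite (horner_size3 _ sd) !coef_deriv (nth_default _ sp) mul0rn.
by rewrite -[p`_2 *+ 2]mulr_natl mulr1n; ring.
Qed.

Lemma hom_lift_some a : hom (a, 1) = ((num f).[a], (den f).[a]).
Proof.
have [sn sd] := size_num_den.
rewrite (horner_size3 _ sn) (horner_size3 _ sd) /qmap /qform /=.
by congr (_, _); ring.
Qed.

Lemma hom_lift_none : hom (1, 0) = ((num f)`_2, (den f)`_2).
Proof. by rewrite /qmap /qform /=; congr (_, _); ring. Qed.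

Lemma rat_evalE p : rat_eval f p = mkpt (hom (lift p)).
Proof. by case: p => [a|]; rewrite /= ?hom_lift_some ?hom_lift_none ?degf. Qed.

Lemma hom_lift_neq0 p : hom (lift p) != (0, 0).
Proof.
case: p => [a|] /=; last first.
  rewrite hom_lift_none; apply/negP => /eqP[n2 d2].
  have sz (p : {poly L}) : (size p <= 3)%N -> p`_2 = 0 -> (size p <= 2)%N.
    rewrite leq_eqVlt => /orP[/eqP sp p2|//].
    have : lead_coef p == 0 by rewrite lead_coefE sp p2.
    by rewrite lead_coef_eq0 => /eqP p0; rewrite p0 size_poly0 in sp.
  have [/sz/(_ n2) sn /sz/(_ d2) sd] := size_num_den.
  have : (maxn (size (num f)) (size (den f)) <= 2)%N by rewrite geq_max sn sd.
  by move: degf; rewrite /degree; case: maxn => // m /= ->.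
rewrite hom_lift_some; apply/negP => /eqP[na da].
have := coprime_num_den f; move/coprimep_root => /(_ a).
by rewrite /root na da !eqxx => /(_ isT).
Qed.

Lemma lift_rat_eval p :
  exists2 a, a != 0 & lift (rat_eval f p) = scalev a (hom (lift p)).
Proof. by rewrite rat_evalE; apply/lift_mkpt/hom_lift_neq0. Qed.

(** A form in the pencil spanned by [num f] and [den f] has a double zero at [z], so the Wronskian
    of the pair vanishes there. *)
Lemma is_critical_qcrit z : is_critical f z -> qcrit (num f) (den f) (lift z).
Proof.
have [sn sd] := size_num_den.
case: z => [a|]; rewrite /is_critical /ram_index /=; last first.
  move=> cr; apply: qcrit_basis; first by rewrite /wedge /= /qform /polar /=; ring.
  have -> : wedge (hom (1, 0)) (qpolar (num f) (den f) (1, 0) (0, 1)) =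
     (num f)`_2 * (den f)`_1 - (den f)`_2 * (num f)`_1.
    by rewrite /wedge /= /qform /polar /=; ring.
  (* A form of degree 2 vanishes to order at least 2 at infinity only if its dehomogenization [g] is
     constant. *)
  have sz (g : {poly L}) : (1 < 2 - (size g).-1)%N -> g`_1 = 0 /\ g`_2 = 0.
    rewrite ltn_subRL => sg; suff sg1 : (size g <= 1)%N.
      by rewrite !nth_default // ltnW.
    by move: sg; case: (size g) => [|[|m]] //; rewrite addn1.
  move: cr; rewrite /proj_pt degf; case: eqP => [d2|/eqP d2N0].
    by move=> /sz[d1 _]; rewrite d2 d1 !(mulr0, mul0r) subrr.
  move=> /sz[]; rewrite !coefB !coefZ => /eqP; rewrite subr_eq0 => /eqP -> _.
  by field.
move=> cr.
suff crit1 : (num f).[a] * (den f)^`().[a] = (den f).[a] * (num f)^`().[a].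
  have crit0 := subrr ((den f).[a] * (num f)^`().[a]).
  rewrite -{1}crit1 !deriv_horner_size3 // !horner_size3 // in crit0.
  apply: qcrit_basis.
    by rewrite -[RHS]crit0 /wedge /= /qform /polar /=; ring.
  (* Euler's relation [polar p u u = 2 * qform p u] at [u = (a, 1)] makes the second wedge equal to
     [- a] times the first. *)
  rewrite -[RHS](mulr0 (- a)) -[in RHS]crit0 /wedge /= /qform /polar /=; ring.
have dvd (g : {poly L}) : (1 < mup a g)%N -> g.[a] = 0 /\ g^`().[a] = 0.
  move=> mg; have : ('X - a%:P) ^+ 2 %| g.
    by have [->|gN0] := eqVneq g 0; rewrite ?dvdp0 // -mup_geq.
  case/dvdpP => h ->; rewrite expr2 !derivM !hornerE ?subrr /=; split; ring.
move: cr; rewrite /proj_pt; case: eqP => [d0 /dvd[_ dd0]|/eqP dN0].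
  by rewrite d0 dd0 mulr0 mul0r.
case/dvd; rewrite !derivE !hornerE => _ /eqP; rewrite subr_eq0 => /eqP ->.
by field.
Qed.

End Degree2.

(** * Coordinates adapted to the critical points *)

Section CriticalBasis.

Variables (L : closedFieldType) (n d : {poly L}) (F : P1 L -> P1 L).
Variables (xi1 xi2 : P1 L).

Notation Q := (qmap n d).
Notation e1 := (lift xi1).
Notation e2 := (lift xi2).

Hypothesis two_neq0 : 2%:R != 0 :> L.
Hypothesis liftF : forall p,
  exists2 a, a != 0 & lift (F p) = scalev a (Q (lift p)).
Hypothesis crit1 : qcrit n d e1.
Hypothesis crit2 : qcrit n d e2.
Hypothesis F_xi_neq : F xi1 != F xi2.

Lemma F_eqE p q : (F p == F q) = (wedge (Q (lift p)) (Q (lift q)) == 0).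
Proof.
have [a aN0 Fp] := liftF p; have [b bN0 Fq] := liftF q.
by rewrite -wedge_lift_eq0 Fp Fq wedgeZl wedgeZr !mulf_eq0 (negPf aN0) (negPf bN0).
Qed.

Lemma lift_iterF k p :
  exists2 a, a != 0 & iter k Q (lift p) = scalev a (lift (iter k F p)).
Proof.
elim: k => [|k [a aN0 IHk]].
  by exists 1; rewrite ?oner_eq0 // /scalev !mul1r -surjective_pairing.
have [b bN0 Fp] := liftF (iter k F p).
exists (a ^+ 2 / b); first by rewrite mulf_neq0 ?expf_neq0 ?invr_neq0.
by rewrite /= IHk qmapZ Fp /scalev /=; congr (_, _); field.
Qed.

Let D := wedge e1 e2.
Let N := wedge (Q e1) (Q e2).

Lemma D_neq0 : D != 0.
Proof. by rewrite wedge_lift_eq0; apply: contra_neq F_xi_neq => ->. Qed.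

Lemma N_neq0 : N != 0.
Proof. by rewrite -F_eqE. Qed.

Definition xcoord u : L := wedge u e2 / D.
Definition ycoord u : L := wedge e1 u / D.

Lemma coordK u : comb (xcoord u) e1 (ycoord u) e2 = u.
Proof.
have DN0 := D_neq0; rewrite /D /wedge in DN0 *.
rewrite /xcoord /ycoord /comb /D /wedge [u in RHS]surjective_pairing.
by congr (_, _); field.
Qed.

(* [B(e1, e2)] is proportional to both [Q e1] and [Q e2], hence it vanishes. *)
Lemma qpolar_e12 : qpolar n d e1 e2 = (0, 0).
Proof.
have c1 := crit1 e2; have c2 := crit2 e1.
have NN0 := N_neq0.
have pC : qpolar n d e2 e1 = qpolar n d e1 e2.
  by rewrite /qpolar /polar; congr (_, _); ring.
rewrite pC in c2; move: c1 c2 NN0; rewrite /N.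
move: (qpolar n d e1 e2) (Q e1) (Q e2) => [b1 b2] [u1 u2] [v1 v2].
rewrite /wedge /= => c1 c2 NN0; congr (_, _); apply: (mulfI NN0).
  have -> : (u1 * v2 - u2 * v1) * b1 =
    v1 * (u1 * b2 - u2 * b1) - u1 * (v1 * b2 - v2 * b1) by ring.
  by rewrite c1 c2 !mulr0 subrr.
have -> : (u1 * v2 - u2 * v1) * b2 =
  v2 * (u1 * b2 - u2 * b1) - u2 * (v1 * b2 - v2 * b1) by ring.
by rewrite c1 c2 !mulr0 subrr.
Qed.

(** The mixed term vanishes by [qpolar_e12]: in the bases [(e1, e2)] and [(Q e1, Q e2)] the map is
    [(x, y) |-> (x^2, y^2)]. *)
Lemma qmap_comb x y :
  Q (comb x e1 y e2) = comb (x ^+ 2) (Q e1) (y ^+ 2) (Q e2).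
Proof.
have [p1 p2] := qpolar_e12.
have E (p : {poly L}) : qform p (comb x e1 y e2) =
    x ^+ 2 * qform p e1 + y ^+ 2 * qform p e2 + x * y * polar p e1 e2.
  by rewrite /qform /polar /comb /=; ring.
by rewrite /qmap !E p1 p2 /comb /= mulr0 !addr0.
Qed.

Lemma qmapE u : Q u = comb (xcoord u ^+ 2) (Q e1) (ycoord u ^+ 2) (Q e2).
Proof. by rewrite -{1}(coordK u) qmap_comb. Qed.

Lemma wedgeE u v :
  wedge u v = (xcoord u * ycoord v - ycoord u * xcoord v) * D.
Proof.
have -> : wedge u v = wedge (comb (xcoord u) e1 (ycoord u) e2)
  (comb (xcoord v) e1 (ycoord v) e2) by rewrite !coordK.
by rewrite /D /wedge /comb /=; ring.
Qed.

Lemma wedge_qmapE u v : wedge (Q u) (Q v) =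
  (xcoord u ^+ 2 * ycoord v ^+ 2 - ycoord u ^+ 2 * xcoord v ^+ 2) * N.
Proof. by rewrite /N (qmapE u) (qmapE v) /wedge /comb /=; ring. Qed.

Lemma xcoord_comb x y : xcoord (comb x e1 y e2) = x.
Proof.
have DN0 := D_neq0; rewrite /xcoord /D /wedge in DN0 *.
by rewrite /comb /=; field.
Qed.

Lemma ycoord_comb x y : ycoord (comb x e1 y e2) = y.
Proof.
have DN0 := D_neq0; rewrite /ycoord /D /wedge in DN0 *.
by rewrite /comb /=; field.
Qed.

Lemma xcoordZ a u : xcoord (scalev a u) = a * xcoord u.
Proof. by rewrite /xcoord wedgeZl mulrA. Qed.

Lemma ycoordZ a u : ycoord (scalev a u) = a * ycoord u.
Proof. by rewrite /ycoord wedgeZr mulrA. Qed.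

Lemma xcoord_lift_eq0 p : (xcoord (lift p) == 0) = (p == xi2).
Proof.
by rewrite -wedge_lift_eq0 /xcoord mulf_eq0 invr_eq0 (negPf D_neq0) orbF.
Qed.

Lemma ycoord_lift_eq0 p : (ycoord (lift p) == 0) = (p == xi1).
Proof.
rewrite [RHS]eq_sym -wedge_lift_eq0 /ycoord mulf_eq0 invr_eq0.
by rewrite (negPf D_neq0) orbF.
Qed.

(** In adapted coordinates the derivative along [e1] already gives [2 x y^2 = 0], so the point lies
    on one of the two axes. This identifies the Galois conjugates of the critical points. *)
Lemma qcrit_lift p : qcrit n d (lift p) -> p = xi1 \/ p = xi2.
Proof.
move=> crp; have [p1 p2] := qpolar_e12; set u := lift p.
have pE (q : {poly L}) : polar q u e1 =
    xcoord u * 2 * qform q e1 + ycoord u * polar q e1 e2.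
  by rewrite -{1}(coordK u) /polar /qform /comb /=; ring.
have := crp e1; rewrite -/u /qpolar !pE p1 p2 !mulr0 !addr0 qmapE.
have -> : wedge (comb (xcoord u ^+ 2) (Q e1) (ycoord u ^+ 2) (Q e2))
    (xcoord u * 2 * qform n e1, xcoord u * 2 * qform d e1) =
    - (xcoord u * (ycoord u) ^+ 2 * N * 2%:R).
  by rewrite /N /wedge /comb /=; ring.
move/eqP; rewrite oppr_eq0 mulf_eq0 (negPf two_neq0) orbF.
rewrite mulf_eq0 (negPf N_neq0) orbF.
rewrite mulf_eq0 expf_eq0 /= /u xcoord_lift_eq0 ycoord_lift_eq0.
by case/orP => /eqP; [right|left].
Qed.

(* In the coordinate [tcoord], which has divisor [xi1 - xi2], the fibres of [F]
   are the pairs [{t, - t}]. *)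
Definition tcoord p : L := wedge e1 (lift p) / wedge e2 (lift p).

Definition deck p : P1 L :=
  mkpt (comb (xcoord (lift p)) e1 (- ycoord (lift p)) e2).

Definition noncritical p := p != xi1 /\ p != xi2.

Lemma tcoordE p : tcoord p = - (ycoord (lift p) / xcoord (lift p)).
Proof.
have DN0 := D_neq0.
have wC : wedge e2 (lift p) = - wedge (lift p) e2 by rewrite /wedge; ring.
rewrite /tcoord /ycoord /xcoord wC.
by rewrite invrN mulrN invfM invrK; congr (- _); rewrite mulrACA mulVf // mulr1.
Qed.

Lemma lift_deck p : exists2 a, a != 0 &
  lift (deck p) = scalev a (comb (xcoord (lift p)) e1 (- ycoord (lift p)) e2).
Proof.
set x := xcoord _; set y := ycoord _.
apply: lift_mkpt; apply/negP => /eqP c0.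
have x0 : x = 0.
  by rewrite -(xcoord_comb x (- y)) c0 /xcoord /wedge !mul0r subrr mul0r.
have y0 : - y = 0.
  by rewrite -(ycoord_comb x (- y)) c0 /ycoord /wedge !mulr0 subrr mul0r.
have := lift_neq0 p; rewrite -(coordK (lift p)) -/x -/y -(opprK y) y0 x0.
by rewrite oppr0 /comb !mul0r !addr0 eqxx.
Qed.

Lemma deck_coord p : exists2 a, a != 0 &
  xcoord (lift (deck p)) = a * xcoord (lift p) /\
  ycoord (lift (deck p)) = - (a * ycoord (lift p)).
Proof.
have [a aN0 dE] := lift_deck p; exists a => //.
by rewrite dE xcoordZ ycoordZ xcoord_comb ycoord_comb mulrN.
Qed.

Lemma F_deck p : F (deck p) = F p.
Proof.
have [a aN0 [xE yE]] := deck_coord p.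
apply/eqP; rewrite F_eqE wedge_qmapE xE yE; apply/eqP.
by ring.
Qed.

Lemma tcoord_deck p : tcoord (deck p) = - tcoord p.
Proof.
have [a aN0 [xE yE]] := deck_coord p.
by rewrite !tcoordE xE yE invfM mulNr mulrACA mulfV // mul1r.
Qed.

Lemma tcoord_neq0 p : noncritical p -> tcoord p != 0.
Proof.
move=> [p1 p2]; rewrite tcoordE oppr_eq0 mulf_neq0 ?invr_eq0 //.
  by rewrite ycoord_lift_eq0.
by rewrite xcoord_lift_eq0.
Qed.

Lemma deck_neq p : noncritical p -> deck p != p.
Proof.
move=> ncp; apply: contraNneq (tcoord_neq0 ncp) => dp.
have /eqP := tcoord_deck p; rewrite dp -addr_eq0 -mulr2n -mulr_natr mulf_eq0.
by rewrite (negPf two_neq0) orbF.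
Qed.

Lemma F_fibre p q : F q = F p -> q = p \/ q = deck p.
Proof.
move/eqP; rewrite F_eqE wedge_qmapE mulf_eq0 (negPf N_neq0) orbF.
rewrite -!exprMn subr_eq0 eqf_sqr => /orP[/eqP E|/eqP E]; [left|right].
  by apply/eqP; rewrite -wedge_lift_eq0 wedgeE E subrr mul0r.
have [a aN0 [xE yE]] := deck_coord p.
apply/eqP; rewrite -wedge_lift_eq0 wedgeE xE yE.
set x := xcoord (lift q); set y := ycoord (lift q).
have -> : x * - (a * ycoord (lift p)) - y * (a * xcoord (lift p)) =
    - a * (x * ycoord (lift p) + y * xcoord (lift p)) by ring.
by rewrite E addNr mulr0 mul0r.
Qed.

Lemma F_surj y : exists p, F p == y.
Proof.
(* The coordinates of [lift y] in the basis [(Q e1, Q e2)]; their square roots are the coordinates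
   of a preimage. *)
pose al := - wedge (Q e2) (lift y) / N; pose be := wedge (Q e1) (lift y) / N.
have NN0 := N_neq0.
have yE : comb al (Q e1) be (Q e2) = lift y.
  rewrite /al /be /N in NN0 *; move: NN0.
  move: (Q e1) (Q e2) (lift y) => [b1 b2] [u1 u2] [v1 v2].
  by rewrite /wedge /comb /= => NN0; congr (_, _); field.
have [a aE] : exists a, a ^+ 2 = al.
  have : size ('X ^+ 2 - al%:P) != 1%N by rewrite size_XnsubC.
  by case/closed_rootP => a; rewrite /root !hornerE subr_eq0 => /eqP; exists a.
have [b bE] : exists b, b ^+ 2 = be.
  have : size ('X ^+ 2 - be%:P) != 1%N by rewrite size_XnsubC.
  by case/closed_rootP => b; rewrite /root !hornerE subr_eq0 => /eqP; exists b.
have cN0 : comb a e1 b e2 != (0, 0).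
  apply/negP => /eqP c0; have := lift_neq0 y.
  rewrite -yE -aE -bE -qmap_comb c0 /qmap /qform /= !(mulr0, expr0n) /=.
  by rewrite !(mulr0, addr0) eqxx.
have [c cN0' lE] := lift_mkpt cN0; exists (mkpt (comb a e1 b e2)).
have [k kN0 FE] := liftF (mkpt (comb a e1 b e2)).
rewrite -wedge_lift_eq0 FE lE qmapZ qmap_comb aE bE yE !wedgeZl.
by rewrite (_ : wedge _ _ = 0) ?mulr0 // /wedge; ring.
Qed.


(** * Norms along iterates of the map and the constant [gamma] *)

Section Norm.

Variables (tree : P1 L -> Prop).
Hypothesis tree_preim : forall p, tree (F p) -> tree p.
Hypothesis tree_noncrit : forall p, tree p -> noncritical p.

(** A function with divisor [E - E']. It depends on the vectors and not only on their points, which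
    keeps track of the constants. *)
Definition ratio (E E' : L * L) p : L := wedge E (lift p) / wedge E' (lift p).

(** The norm of [wedge V] along a fibre is [wedge (Q V)] up to a factor independent of [V], which
    cancels in the quotient. *)
Lemma ratio_fibre E E' p :
  ratio E E' (deck p) * ratio E E' p = ratio (Q E) (Q E') (F p).
Proof.
have [a aN0 [xE yE]] := deck_coord p; have [b bN0 FE] := liftF p.
have key V : wedge V (lift (deck p)) * wedge V (lift p) =
    - (a * D ^+ 2 / (b * N)) * wedge (Q V) (lift (F p)).
  rewrite FE wedgeZr wedge_qmapE !wedgeE xE yE.
  have NN0 := N_neq0; by field; rewrite NN0 bN0.
have : - (a * D ^+ 2 / (b * N)) != 0.
  by rewrite oppr_eq0 !(mulf_neq0, invr_neq0, expf_neq0) ?D_neq0 ?N_neq0.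
move: (- _) key => h key hN0.
by rewrite /ratio mulrACA -invfM !key invfM mulrACA mulfV ?mul1r.
Qed.

Lemma prod_ratio c k E E' y : is_section F tree c -> tree y ->
  \prod_(u : k.-tuple bool) ratio E E' (desc deck c y u) =
  ratio (iter k Q E) (iter k Q E') y.
Proof.
move=> cP ty; elim: k E E' => [|k IHk] E E'.
  rewrite (bigD1 [tuple]) //= big1 ?mulr1 // => u.
  by rewrite (tuple0 u) => /eqP.
rewrite (@prod_rcons_tuple _ _ (fun s => ratio E E' (desc deck c y s))) !iterSr -IHk.
apply: eq_bigr => u _; rewrite !desc_rcons /= ratio_fibre cP //.
exact: (tree_desc tree_preim (fun p _ => F_deck p) cP).
Qed.

(** The square of [tcoord] has divisor [2 xi1 - 2 xi2], the pullback of [F xi1 - F xi2]; the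
    coordinates give the constant -1. *)
Lemma tcoord_sqr p : tcoord p ^+ 2 = - ratio (Q e1) (Q e2) (F p).
Proof.
have [b bN0 FE] := liftF p.
rewrite /ratio FE !wedgeZr invfM mulrACA mulfV // mul1r (qmapE (lift p)).
set x := xcoord _; set y := ycoord _.
have -> : wedge (Q e1) (comb (x ^+ 2) (Q e1) (y ^+ 2) (Q e2)) = y ^+ 2 * N.
  by rewrite /N /wedge /comb /=; ring.
have -> : wedge (Q e2) (comb (x ^+ 2) (Q e1) (y ^+ 2) (Q e2)) = - (x ^+ 2 * N).
  by rewrite /N /wedge /comb /=; ring.
rewrite tcoordE -/x -/y sqrrN expr_div_n invrN mulrN opprK.
by rewrite [(_ * N)^-1]invfM [RHS]mulrACA mulfV ?mulr1 // N_neq0.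
Qed.

Variables (k : nat) (k_gt0 : (0 < k)%N).
Hypothesis collision : iter k.+1 F xi1 = iter k.+1 F xi2.
Hypothesis no_collision : iter k F xi1 != iter k F xi2.
Hypothesis orbit_tree : forall m, ~ tree (iter m F xi2).

Definition gamma : L := xcoord (iter k Q e1) / xcoord (iter k Q e2).

(** The points [F^k(xi1)] and [F^k(xi2)] are distinct with the same image under [F], so their
    coordinates agree up to scaling and one sign: those of [Q^k e1] are [(gamma x, - gamma y)] if
    those of [Q^k e2] are [(x, y)]. *)
Lemma gammaP : [/\ xcoord (iter k Q e2) != 0, ycoord (iter k Q e1) != 0,
  xcoord (iter k Q e1) != 0 &
  ycoord (iter k Q e1) = - gamma * ycoord (iter k Q e2)].
Proof.
rewrite /gamma; set V1 := iter k Q e1; set V2 := iter k Q e2.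
have [a aN0 V1E] := lift_iterF k xi1; have [b bN0 V2E] := lift_iterF k xi2.
have wN0 : xcoord V1 * ycoord V2 != ycoord V1 * xcoord V2.
  move: no_collision; rewrite -wedge_lift_eq0; apply: contra_neq => E.
  have /eqP : wedge V1 V2 = 0 by rewrite wedgeE E subrr mul0r.
  rewrite /V1 /V2 V1E V2E wedgeZl wedgeZr !mulf_eq0 (negPf aN0) (negPf bN0).
  by move/eqP.
have w0 : (xcoord V1 * ycoord V2) ^+ 2 = (ycoord V1 * xcoord V2) ^+ 2.
  have [a' aN0' W1E] := lift_iterF k.+1 xi1.
  have [b' bN0' W2E] := lift_iterF k.+1 xi2.
  have : wedge (Q V1) (Q V2) == 0.
    rewrite -!iterS W1E W2E wedgeZl wedgeZr !mulf_eq0 wedge_lift_eq0.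
    by rewrite collision eqxx !orbT.
  rewrite wedge_qmapE mulf_eq0 (negPf N_neq0) orbF subr_eq0 => /eqP.
  by rewrite !exprMn.
have {w0} wE : xcoord V1 * ycoord V2 = - (ycoord V1 * xcoord V2).
  by move/eqP: w0; rewrite eqf_sqr (negPf wN0) => /eqP.
have pN0 : ycoord V1 * xcoord V2 != 0.
  by apply: contraNneq wN0 => z; rewrite wE z oppr0.
have := pN0; rewrite -oppr_eq0 -wE mulf_eq0 => /norP[x1 y2].
move: pN0; rewrite mulf_eq0 => /norP[y1 x2]; split=> //.
by apply: (mulIf x2); rewrite -[LHS]opprK -wE; field.
Qed.

Lemma gamma_neq0 : gamma != 0.
Proof. by have [x2 _ x1 _] := gammaP; rewrite mulf_neq0 ?invr_eq0. Qed.

(** By [tcoord_sqr] and [prod_ratio] the square is the [ratio] of the vectors [Q^(k+1) e1] and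
    [Q^(k+1) e2], which are collinear by the collision. *)
Lemma prod_tcoord_sqr c y : is_section F tree c -> tree y ->
  (\prod_(u : k.-tuple bool) tcoord (c (desc deck c y u))) ^+ 2 = gamma ^+ 2.
Proof.
move=> cP ty; rewrite -prodrXl.
rewrite (eq_bigr (fun u : k.-tuple bool =>
    (-1) * ratio (Q e1) (Q e2) (desc deck c y u))) => [|u _]; last first.
  rewrite tcoord_sqr cP ?mulN1r //.
  exact: (tree_desc tree_preim (fun p _ => F_deck p) cP).
rewrite big_split /= prodr_const card_tuple card_bool prod_ratio //.
(* The sign is -1 to the power [2^k], which is even because [k > 0]. *)
rewrite -signr_odd oddX eqn0Ngt k_gt0 /= mul1r -!iterSr.
have [x2 y1 x1 y1E] := gammaP.
have -> : iter k.+1 Q e1 = scalev (gamma ^+ 2) (iter k.+1 Q e2).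
  rewrite !iterS qmapE y1E.
  have -> : xcoord (iter k Q e1) = gamma * xcoord (iter k Q e2).
    by rewrite /gamma divfK.
  rewrite [Q (iter k Q e2)]qmapE /comb /scalev /=; congr (_, _); ring.
rewrite /ratio wedgeZl mulfK //.
have [a aN0 ->] := lift_iterF k.+1 xi2.
(* The denominator is nonzero because no point of the tree lies on the forward orbit of [xi2]. *)
rewrite wedgeZl mulf_neq0 // wedge_lift_eq0; apply/eqP => yE.
by apply: (@orbit_tree k.+1); rewrite yE.
Qed.

(** * Conjugation by a field endomorphism *)

Section Conjugation.

Variable tau : {rmorphism L -> L}.
Hypothesis tau_n : map_poly tau n = n.
Hypothesis tau_d : map_poly tau d = d.
Hypothesis tau_tree : forall p, tree p -> tree (omap tau p).

Definition mapv (u : L * L) : L * L := (tau u.1, tau u.2).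

Lemma lift_omap p : lift (omap tau p) = mapv (lift p).
Proof. by case: p => [a|]; rewrite /mapv /= ?rmorph1 ?rmorph0. Qed.

Lemma rmorph_wedge u v : tau (wedge u v) = wedge (mapv u) (mapv v).
Proof. by rewrite /wedge rmorphB !rmorphM. Qed.

Lemma tau_coef (p : {poly L}) i : map_poly tau p = p -> tau p`_i = p`_i.
Proof. by move=> {2}<-; rewrite coef_map. Qed.

Lemma rmorph_qform (p : {poly L}) u :
  map_poly tau p = p -> tau (qform p u) = qform p (mapv u).
Proof.
by move=> pE; rewrite /qform !rmorphD !rmorphM !tau_coef //= -!expr2 !rmorphXn.
Qed.

Lemma mapv_qmap u : mapv (Q u) = Q (mapv u).
Proof. by rewrite /mapv /qmap /= !rmorph_qform. Qed.

Lemma mapv_iter_qmap m u : mapv (iter m Q u) = iter m Q (mapv u).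
Proof. by elim: m => //= m IHm; rewrite mapv_qmap IHm. Qed.

Lemma omapF p : omap tau (F p) = F (omap tau p).
Proof.
have [a aN0 FE] := liftF p; have [b bN0 FE'] := liftF (omap tau p).
apply/eqP; rewrite -wedge_lift_eq0 lift_omap FE FE' lift_omap wedgeZr -mapv_qmap.
have -> : mapv (scalev a (Q (lift p))) = scalev (tau a) (mapv (Q (lift p))).
  by rewrite /mapv /scalev /= !rmorphM.
by rewrite wedgeZl (_ : wedge _ _ = 0) ?mulr0 // /wedge; ring.
Qed.

Lemma omap_inj : injective (omap tau).
Proof. by move=> [a|] [b|] //= [/(fmorph_inj tau) ->]. Qed.

Lemma qcrit_mapv u : qcrit n d u -> qcrit n d (mapv u).
Proof.
have E v : mapv (qpolar n d u v) = qpolar n d (mapv u) (mapv v).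
  rewrite /mapv /qpolar /polar /= !(rmorphD, rmorphM) /= !tau_coef //.
  by rewrite !rmorph1.
move=> cr; apply: qcrit_basis.
  have := congr1 tau (cr (1, 0)); rewrite rmorph_wedge mapv_qmap E rmorph0.
  by rewrite /mapv /= rmorph1 rmorph0.
have := congr1 tau (cr (0, 1)); rewrite rmorph_wedge mapv_qmap E rmorph0.
by rewrite /mapv /= rmorph1 rmorph0.
Qed.

(** As [tau] fixes the coefficients of [Q], it sends critical points to critical points, and it does
    so injectively. *)
Lemma conj_xi : if omap tau xi1 == xi1 then omap tau xi2 = xi2
                else omap tau xi1 = xi2 /\ omap tau xi2 = xi1.
Proof.
have c1 : qcrit n d (lift (omap tau xi1)) by rewrite lift_omap; apply: qcrit_mapv.
have c2 : qcrit n d (lift (omap tau xi2)) by rewrite lift_omap; apply: qcrit_mapv.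
have xiN : xi2 != xi1 by apply: contra_neq F_xi_neq => ->.
case: eqP => [t1|t1].
  have [t2|//] := qcrit_lift c2.
  by move: xiN; rewrite -(inj_eq omap_inj) t1 t2 eqxx.
have [//|t1'] := qcrit_lift c1.
have [t2|t2] := qcrit_lift c2; split=> //.
by move: xiN; rewrite -(inj_eq omap_inj) t1' t2 eqxx.
Qed.

(** With [c' := c], [prod_transport] gives [(-1)^e gamma] for the product of the [t(tau p)].
    Comparison with [tau gamma], the product of the [tau (t p)], determines [e]. *)
Lemma odd_flips c y : is_section F tree c -> tree y ->
  (forall z, tree z ->
     \prod_(u : k.-tuple bool) tcoord (c (desc deck c z u)) = gamma) ->
  \big[addb/false]_(u : k.-tuple bool) flip deck c c (omap tau) y u =
    (omap tau xi1 != xi1).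
Proof.
move=> cP ty cg.
have := @prod_transport _ F deck tree tree_preim (fun p _ => F_deck p)
  (fun p tp => deck_neq (tree_noncrit tp)) (fun p q _ => @F_fibre p q)
  c c cP cP (omap tau) omap_inj omapF tau_tree y ty L tcoord k
  (fun p _ => tcoord_deck p).
rewrite cg; last exact: tau_tree.
set e := \big[addb/false]_u _ => prodE.
have tauP : tau gamma =
    \prod_(u : k.-tuple bool) tau (tcoord (c (desc deck c y u))).
  by rewrite -(cg y ty) rmorph_prod.
have gN0 := gamma_neq0; have [x2 y1 x1 y1E] := gammaP.
have oneN : (1 : L) != -1 by rewrite -addr_eq0.
have := conj_xi; case: eqP => /= [t1 t2|_ [t1 t2]].
  have te1 : mapv e1 = e1 by rewrite -lift_omap t1.
  have te2 : mapv e2 = e2 by rewrite -lift_omap t2.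
  have tg : tau gamma = gamma.
    rewrite /gamma /xcoord fmorph_div !fmorph_div !rmorph_wedge !mapv_iter_qmap.
    by rewrite te1 te2.
  have : (-1) ^+ e * gamma = gamma.
    rewrite -prodE -[RHS]tg tauP; apply: eq_bigr => u _.
    by rewrite /tcoord fmorph_div !rmorph_wedge te1 te2 lift_omap.
  case: (e) => //=; rewrite mulN1r => /eqP; rewrite eq_sym -{1}[gamma]mul1r -mulN1r.
  by rewrite (inj_eq (mulIf gN0)) (negPf oneN).
(* Since [lift] is normalised, [tau] exchanges the vectors [e1] and [e2] themselves, not only their
   lines. *)
have te1 : mapv e1 = e2 by rewrite -lift_omap t1.
have te2 : mapv e2 = e1 by rewrite -lift_omap t2.
have txy u : tau (xcoord u) = ycoord (mapv u).
  rewrite /xcoord /ycoord fmorph_div /D !rmorph_wedge te1 te2.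
  rewrite -[wedge e2 e1]opprK -[wedge (mapv u) e1]opprK invrN mulrNN.
  by congr (_ / _); rewrite /wedge; ring.
(* The conjugate of [gamma] is the quotient of the [y]-coordinates of [Q^k e2] and [Q^k e1], known
   by [gammaP]. *)
have tg : tau gamma = - gamma^-1.
  rewrite {1}/gamma fmorph_div !txy !mapv_iter_qmap te1 te2.
  rewrite y1E invfM mulrCA mulfV ?mulr1 ?invrN //.
  by apply: contraNneq y1 => y0; rewrite y1E y0 mulr0.
(* Here [tau (t p)] is the inverse of [t(tau p)], so [tau gamma] is the inverse of the transported
   product. *)
have : ((-1) ^+ e * gamma)^-1 = - gamma^-1.
  rewrite -prodE -tg tauP -prodfV; apply: eq_bigr => u _.
  by rewrite /tcoord fmorph_div !rmorph_wedge te1 te2 lift_omap invf_div.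
case: (e) => //=; rewrite mul1r => /eqP; rewrite -{1}[gamma^-1]mul1r -mulN1r.
by rewrite (inj_eq (mulIf (invr_neq0 gN0))) (negPf oneN).
Qed.

End Conjugation.

End Norm.

End CriticalBasis.

(** * The Galois action on the preimage tree *)

Section Subfields.

Variables (L : fieldType) (E : L -> Prop) (Efield : is_subfield E).

Lemma subfield0 : E 0.
Proof. by have [E1 EB _] := Efield; rewrite -(subrr 1); apply: EB. Qed.

Lemma subfieldB a b : E a -> E b -> E (a - b).
Proof. by have [_ EB _] := Efield; apply: EB. Qed.

Lemma subfieldV a b : E a -> E b -> E (a / b).
Proof. by have [_ _ EV] := Efield; apply: EV. Qed.

Lemma subfieldD a b : E a -> E b -> E (a + b).
Proof.
move=> Ea Eb; rewrite -[b]opprK; apply: subfieldB => //.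
by rewrite -sub0r; apply: subfieldB => //; apply: subfield0.
Qed.

Lemma subfieldM a b : E a -> E b -> E (a * b).
Proof.
move=> Ea Eb; rewrite -[b]invrK; apply: subfieldV => //.
by rewrite -div1r; apply: subfieldV => //; case: Efield.
Qed.

Lemma subfield_horner (K : fieldType) (iota : {rmorphism K -> L})
    (p : {poly K}) a :
  (forall c, E (iota c)) -> E a -> E (map_poly iota p).[a].
Proof.
move=> EK Ea; elim/poly_ind: p => [|p c IHp].
  by rewrite rmorph0 horner0; apply: subfield0.
rewrite rmorphD rmorphM /= map_polyX map_polyC !hornerE /=.
by apply: subfieldD => //; apply: subfieldM.
Qed.

End Subfields.

Lemma adjoin_subfield (K L : fieldType) (iota : {rmorphism K -> L})
    (S : L -> Prop) :
  is_subfield (adjoin iota S).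
Proof.
split=> [E [] //|a b Ea Eb E EF EK ES|a b Ea Eb E EF EK ES].
  by apply: subfieldB => //; [apply: Ea | apply: Eb].
by apply: subfieldV => //; [apply: Ea | apply: Eb].
Qed.

(** At the root the permutation is the action on level [m], and two labelings give permutations
    conjugate under the relabeling [th]. This allows an arbitrary labeling to be compared with the
    constructed one. *)
Lemma is_sgn_root_uniq (L : fieldType) (F : P1 L -> P1 L) (x : P1 L)
    (lab lab' : node F x -> seq bool) (m : nat) (sigma : node F x -> node F x)
    (e e' : int) :
  is_labeling lab -> is_labeling lab' ->
  (forall u, level (sigma u) = level u) ->
  is_sgn lab m sigma (tree_root F x) e ->
  is_sgn lab' m sigma (tree_root F x) e' ->
  e = e'.
Proof.
move=> [szl [g labK gK] _] [szl' lab'bij _] sigl [pi piP ->] [pi' piP' ->].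
have root_nil (lb : node F x -> seq bool) :
    (forall u : node F x, size (lb u) = level u) ->
    lb (tree_root F x) = [::] /\ lb (sigma (tree_root F x)) = [::].
  by move=> sz; split; apply/nilP; rewrite /nilp sz ?sigl.
have [r0 sr0] := root_nil _ szl; have [r0' sr0'] := root_nil _ szl'.
have szth (s : m.-tuple bool) : size (lab' (g s)) == m.
  by rewrite szl' -szl gK size_tuple.
pose th s := Tuple (szth s).
have th_inj : injective th.
  by move=> s t /(congr1 val) /= /(bij_inj lab'bij) /(can_inj gK)/val_inj.
have thE s : th (pi s) = pi' (th s).
  apply: val_inj => /=; have := piP' (g s) (th s).
  rewrite r0' sr0' => /(_ erefl) /= <-; congr (lab' _); apply: (can_inj labK).
  by rewrite gK (piP (g s) s) ?sr0 // gK r0.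
have : (pi * perm th_inj = perm th_inj * pi')%g.
  by apply/permP => s; rewrite !permM !permE thE.
move/(congr1 (@odd_perm _)); rewrite !odd_permM addbC => /addbI ->.
by [].
Qed.

(** * The collision setting, with [l = k.+1] *)

Section Collision.

Variables (K : fieldType) (Kbar : closedFieldType) (iota : {rmorphism K -> Kbar}).
Variables (f : ratfun K) (xi1 xi2 : P1 Kbar) (x0 : P1 K) (k : nat).

Local Notation F := (rat_eval (map_ratfun iota f)).
Local Notation x := (omap iota x0).
Local Notation n := (map_poly iota (num f)).
Local Notation d := (map_poly iota (den f)).

Hypothesis charK : 2%N \notin [pchar K].
Hypothesis algKbar : forall a : Kbar, algebraicOver iota a.
Hypothesis degf : degree f = 2%N.
Hypothesis crit1 : is_critical (map_ratfun iota f) xi1.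
Hypothesis crit2 : is_critical (map_ratfun iota f) xi2.
Hypothesis orbit1 : forall m, iter m F xi1 <> x.
Hypothesis orbit2 : forall m, iter m F xi2 <> x.
Hypothesis k_gt0 : (0 < k)%N.
Hypothesis collision : iter k.+1 F xi1 = iter k.+1 F xi2.
Hypothesis no_collision : iter k F xi1 != iter k F xi2.

Lemma two_neq0K : 2%:R != 0 :> K.
Proof. by move: charK; rewrite inE. Qed.

Lemma two_neq0 : 2%:R != 0 :> Kbar.
Proof. by rewrite -(rmorph_nat iota) fmorph_eq0 two_neq0K. Qed.

Lemma deg_map : degree (map_ratfun iota f) = 2%N.
Proof. by rewrite -degf /degree /= !size_map_poly. Qed.

Lemma liftF p : exists2 a, a != 0 & lift (F p) = scalev a (qmap n d (lift p)).
Proof. exact: (lift_rat_eval deg_map). Qed.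

Lemma qcrit1 : qcrit n d (lift xi1).
Proof. exact: (is_critical_qcrit deg_map crit1). Qed.

Lemma qcrit2 : qcrit n d (lift xi2).
Proof. exact: (is_critical_qcrit deg_map crit2). Qed.

Lemma F_xi_neq : F xi1 != F xi2.
Proof.
apply: contra_neq no_collision; case: k k_gt0 => // m _ FE.
by rewrite !iterSr FE.
Qed.

Definition in_tree p : Prop := exists m, iter m F p = x.

Lemma tree_preim p : in_tree (F p) -> in_tree p.
Proof. by case=> m h; exists m.+1; rewrite iterSr. Qed.

Lemma tree_noncrit p : in_tree p -> noncritical xi1 xi2 p.
Proof.
by case=> m h; split; apply/eqP => pE; rewrite pE in h;
  [apply: orbit1 h | apply: orbit2 h].
Qed.

Lemma orbit_tree m : ~ in_tree (iter m F xi2).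
Proof. by case=> j; rewrite -iterD; apply: orbit2. Qed.

Lemma tree_x : in_tree x. Proof. by exists 0%N. Qed.

Lemma tree_point (u : node F x) : in_tree (point u).
Proof. by exists (level u); apply/eqP/(valP u). Qed.

Local Notation dk := (deck xi1 xi2).
Local Notation t := (tcoord xi1 xi2).

Lemma dk_F p : in_tree p -> F (dk p) = F p.
Proof. by move=> _; apply: (F_deck liftF qcrit1 qcrit2 F_xi_neq). Qed.

Lemma dk_neq p : in_tree p -> dk p != p.
Proof. by move=> tp; apply: (deck_neq two_neq0 F_xi_neq (tree_noncrit tp)). Qed.

Lemma dk_fibre p q : in_tree p -> F q = F p -> q = p \/ q = dk p.
Proof. by move=> _; apply: (F_fibre liftF qcrit1 qcrit2 F_xi_neq). Qed.

Lemma F_onto y : exists p, F p == y.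
Proof. exact: (F_surj liftF qcrit1 qcrit2 F_xi_neq). Qed.

Lemma exists_signed_section : exists2 c, is_section F in_tree c &
  forall y, in_tree y ->
    \prod_(u : k.-tuple bool) t (c (desc dk c y u)) = gamma n d xi1 xi2 k.
Proof.
have c0P : is_section F in_tree (fun y => xchoose (F_onto y)).
  by move=> y _; apply/eqP/(xchooseP (F_onto y)).
apply: (signed_section tree_preim dk_F dk_neq dk_fibre _ _ c0P).
- by move=> p _; apply: (tcoord_deck F_xi_neq).
- move=> c y cP ty; exact: (prod_tcoord_sqr liftF qcrit1 qcrit2 F_xi_neq
    tree_preim k_gt0 collision no_collision orbit_tree cP ty).
Qed.

Section Galois.

Variable tau : {rmorphism Kbar -> Kbar}.
Hypothesis tauK : forall c, tau (iota c) = iota c.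

Lemma tau_map_poly (p : {poly K}) :
  map_poly tau (map_poly iota p) = map_poly iota p.
Proof. by rewrite -map_poly_comp (eq_map_poly (tauK : tau \o iota =1 iota)). Qed.

Lemma tauF p : omap tau (F p) = F (omap tau p).
Proof. exact: (omapF liftF (tau_map_poly _) (tau_map_poly _)). Qed.

Lemma tau_x : omap tau x = x.
Proof. by case: x0 => //= a; rewrite tauK. Qed.

Lemma tau_iterF m p : omap tau (iter m F p) = iter m F (omap tau p).
Proof. by elim: m => //= m IHm; rewrite tauF IHm. Qed.

Lemma iter_tau m p : iter m F (omap tau p) = x <-> iter m F p = x.
Proof.
rewrite -tau_iterF -{1}tau_x; split=> [/(@omap_inj _ tau)|-> //].
exact.
Qed.

Lemma tau_tree p : in_tree p -> in_tree (omap tau p).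
Proof. by case=> m h; exists m; apply/iter_tau. Qed.

Section Action.

Variable sigma : node F x -> node F x.
Hypothesis sigma_level : forall u, level (sigma u) = level u.
Hypothesis sigma_point : forall u, point (sigma u) = omap tau (point u).

Lemma node_inj (u v : node F x) : level u = level v -> point u = point v -> u = v.
Proof.
rewrite /level /point => h1 h2; apply: val_inj.
by rewrite [LHS]surjective_pairing [RHS]surjective_pairing h1 h2.
Qed.

Lemma sigma_tree_aut : is_tree_aut sigma.
Proof.
have [tau' tauK' tau'K] := rmorphism_bij algKbar tauK.
have omK p : omap tau (omap tau' p) = p by case: p => //= a; rewrite tau'K.
have inv_ok (u : node F x) : iter (level u) F (omap tau' (point u)) == x.
  by apply/eqP/iter_tau; rewrite omK; apply/eqP/(valP u).
pose rho (u : node F x) : node F x :=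
  exist (fun u : nat * P1 Kbar => iter u.1 F u.2 == x)
    (level u, omap tau' (point u)) (inv_ok u).
have rhoK : cancel rho sigma.
  by move=> u; apply: node_inj; rewrite ?sigma_level ?sigma_point //= omK.
split.
- exists rho => // u; apply: node_inj; rewrite /level /point /=.
    exact: sigma_level.
  by apply: (@omap_inj _ tau); rewrite omK -sigma_point.
- by apply: node_inj; rewrite ?sigma_level ?sigma_point //= tau_x.
- move=> u v; rewrite /edge !sigma_level !sigma_point -tauF.
  by split=> -[-> h]; split=> //; [apply: omap_inj h|rewrite h].
Qed.

Variables (c : P1 Kbar -> P1 Kbar) (cP : is_section F in_tree c).
Hypothesis c_gamma : forall y, in_tree y ->
    \prod_(u : k.-tuple bool) t (c (desc dk c y u)) = gamma n d xi1 xi2 k.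

Definition node_label (u : node F x) : seq bool := label F c (level u) (point u).

Lemma desc_node_label (u : node F x) : desc dk c x (node_label u) = point u.
Proof.
have h : iter (level u) F (point u) = x by apply/eqP/(valP u).
rewrite -{1}h (desc_label tree_preim dk_fibre cP) // h; exact: tree_x.
Qed.

(** The permutation at [y] is [transport], so its sign counts flips, and [odd_flips] gives the same
    parity at every node. *)
Lemma sigma_sgn y :
  is_sgn node_label k.+1 sigma y ((-1) ^+ (omap tau xi1 != xi1)).
Proof.
have ty := tree_point y.
have inj := @transport_inj _ F dk in_tree tree_preim dk_F dk_neq dk_fibre
  c c cP cP (omap tau) (@omap_inj _ tau) tauF tau_tree (point y) ty k.+1.
exists (perm inj) => [v s vE|].
  have pv : point v = desc dk c (point y) s.
    by rewrite -desc_node_label vE desc_cat desc_node_label.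
  have lv : level v = (level y + k.+1)%N.
    have := congr1 size vE; rewrite size_cat size_tuple /node_label.
    by rewrite !size_label.
  rewrite permE /node_label !sigma_level !sigma_point lv label_add pv.
  by rewrite -tau_iterF (iter_desc_tuple tree_preim dk_F cP).
rewrite (odd_transport (pi := perm inj) tree_preim dk_F dk_neq dk_fibre cP cP
  (@omap_inj _ tau) tauF tau_tree ty) => [|u]; last by rewrite permE.
by rewrite (odd_flips two_neq0 liftF qcrit1 qcrit2 F_xi_neq tree_preim tree_noncrit
  collision no_collision (tau_map_poly _) (tau_map_poly _) tau_tree cP ty c_gamma).
Qed.

End Action.

End Galois.

Section Labeling.

Variables (c : P1 Kbar -> P1 Kbar) (cP : is_section F in_tree c).

Lemma node_label_labeling : is_labeling (node_label c).
Proof.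
have ok w : iter (size w) F (desc dk c x w) == x.
  by rewrite (iter_desc tree_preim dk_F cP) //; apply: tree_x.
pose g w : node F x :=
  exist (fun u : nat * P1 Kbar => iter u.1 F u.2 == x)
    (size w, desc dk c x w) (ok w).
split.
- by move=> u; rewrite size_label.
- exists g => [u|w].
    apply: node_inj; rewrite /level /point /= ?size_label //.
    exact: desc_node_label.
  rewrite /node_label /level /point /= (label_desc tree_preim dk_F dk_neq cP) //.
  exact: tree_x.
move=> u v [lv pv]; exists (point v != c (F (point v))).
by rewrite /node_label lv /= pv.
Qed.

End Labeling.

(** * The field [K_infty] and its automorphisms *)

Local Notation Kinf := (K_infty iota F x).

(** A finite point of level [m] is the image of some [z] of the next level, hence the quotient of
    the values of [num f] and [den f] at [z], or of their coefficients of degree 2 if [z] is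
    infinite. *)
Lemma K_level_succ m a : K_level iota F x m a -> K_level iota F x m.+1 a.
Proof.
move=> Ka E EF EK ES; apply: Ka => // b bx.
have [z /eqP Fz] := F_onto (Some b).
have zx : iter m.+1 F z = x by rewrite iterSr Fz.
case: z Fz zx => [z|] Fz zx; move: Fz; rewrite /= /proj_pt; case: eqP => // _ [<-].
  have Ez := ES z zx.
  by apply: subfieldV => //; apply: subfield_horner.
by rewrite !coef_map; apply: subfieldV => //; apply: EK.
Qed.

Lemma K_level_le m m' a :
  (m <= m')%N -> K_level iota F x m a -> K_level iota F x m' a.
Proof. by move/subnK <-; elim: (m' - m)%N => //= j IHj /IHj/K_level_succ. Qed.

Lemma K_infty_subfield : is_subfield Kinf.
Proof.
split.
- by exists 0%N; have [] := adjoin_subfield iota (fun b => iter 0 F (Some b) = x).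
- move=> a b [m Ka] [m' Kb]; exists (maxn m m').
  by apply: (subfieldB (adjoin_subfield iota _));
    [apply: K_level_le Ka|apply: K_level_le Kb]; rewrite ?leq_maxl ?leq_maxr.
- move=> a b [m Ka] [m' Kb]; exists (maxn m m').
  by apply: (subfieldV (adjoin_subfield iota _));
    [apply: K_level_le Ka|apply: K_level_le Kb]; rewrite ?leq_maxl ?leq_maxr.
Qed.

Lemma K_infty_iota a : Kinf (iota a).
Proof. by exists 0%N => E _ EK _; apply: EK. Qed.

Lemma K_infty_point (u : node F x) a : point u = Some a -> Kinf a.
Proof.
move=> pu; exists (level u) => E _ _; apply; rewrite -pu.
by apply/eqP/(valP u).
Qed.

(** The graph of [s] over [K_infty] is a [hom_graph], so it extends to the algebraic closure. *)
Lemma gal_extend s : is_gal iota Kinf s -> exists2 tau : {rmorphism Kbar -> Kbar},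
  forall a, tau (iota a) = iota a & forall a, Kinf a -> tau a = s a.
Proof.
case=> _ _ sD sM sK; have KF := K_infty_subfield.
have s0 : s 0 = 0 by rewrite -(rmorph0 iota) sK rmorph0.
have sB a b : Kinf a -> Kinf b -> s (a - b) = s a - s b.
  move=> Ka Kb; apply: (addIr (s b)); rewrite -sD ?subrK //.
  exact: subfieldB.
pose G : set (Kbar * Kbar) := fun u => Kinf u.1 /\ u.2 = s u.1.
have Ghom : hom_graph iota G.
  split.
  - by move=> a; split; [apply: K_infty_iota | rewrite sK].
  - move=> u v [Ku uE] [Kv vE]; split=> /=; first exact: subfieldB.
    by rewrite sB // uE vE.
  - move=> u v [Ku uE] [Kv vE]; split=> /=; first exact: subfieldM.
    by rewrite sM // uE vE.
  - by move=> b [_ /= ->].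
have [tau tauG] := hom_graph_rmorphism algKbar Ghom.
have tauE a : Kinf a -> tau a = s a by move=> Ka; apply: (tauG (a, s a)).
by exists tau => // a; rewrite tauE ?sK //; apply: K_infty_iota.
Qed.

(** Preimages and images of subfields under [tau] are subfields, and [tau] permutes each fibre of
    generators; the preimage gives stability of [K_infty], the image surjectivity. *)
Lemma rmorphism_gal (tau : {rmorphism Kbar -> Kbar}) :
  (forall a, tau (iota a) = iota a) -> is_gal iota Kinf tau.
Proof.
move=> tauK; have [tau' tauK' tau'K] := rmorphism_bij algKbar tauK.
split=> //.
- move=> a [m Ka]; exists m => E EF EK ES.
  apply: (Ka (fun a => E (tau a))).
  + split; rewrite ?rmorph1; first by case: EF.
      by move=> b b' Eb Eb'; rewrite rmorphB; apply: subfieldB.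
    by move=> b b' Eb Eb'; rewrite fmorph_div; apply: subfieldV.
  + by move=> b; rewrite tauK.
  + by move=> b bx; apply: ES; apply/(iter_tau tauK m (Some b)).
- move=> b [m Kb]; exists (tau' b) => //; exists m => E EF EK ES.
  have [a Ea <-] : exists2 a, E a & tau a = b; last by rewrite tauK'.
  apply: (Kb (fun b => exists2 a, E a & tau a = b)).
  + split; first by exists 1; rewrite ?rmorph1; case: EF.
      move=> _ _ [a Ea <-] [a' Ea' <-]; exists (a - a'); last by rewrite rmorphB.
      exact: subfieldB.
    move=> _ _ [a Ea <-] [a' Ea' <-]; exists (a / a'); last by rewrite fmorph_div.
    exact: subfieldV.
  + by move=> a; exists (iota a).
  + move=> b0 bx; exists (tau' b0) => //; apply: ES.
    by apply/(iter_tau tauK); rewrite /= tau'K.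
- by move=> a b _ _; rewrite rmorphD.
- by move=> a b _ _; rewrite rmorphM.
Qed.

(** The default [u] of [insubd] is returned when the pair is not a node, which by [node_actE] never
    happens for a Galois element. *)
Definition node_act (s : Kbar -> Kbar) (u : node F x) : node F x :=
  insubd u (level u, omap s (point u)).

Lemma node_actE s (tau : {rmorphism Kbar -> Kbar}) :
  (forall a, tau (iota a) = iota a) -> (forall a, Kinf a -> tau a = s a) ->
  forall u, [/\ level (node_act s u) = level u,
    point (node_act s u) = omap tau (point u)
    & omap tau (point u) = omap s (point u)].
Proof.
move=> tauK tauE u.
have omE : omap tau (point u) = omap s (point u).
  by case pu: (point u) => [a|] //=; rewrite tauE //; apply: K_infty_point pu.
have ok : iter (level u) F (omap s (point u)) == x.
  by rewrite -omE; apply/eqP/(iter_tau tauK)/eqP/(valP u).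
have vE : val (node_act s u) = (level u, omap s (point u)).
  by rewrite /node_act val_insubd ok.
by rewrite {1}/level {1}/point vE omE.
Qed.

(** Every Galois element extends to the algebraic closure, so membership in [Mx] only has to be
    checked for actions of endomorphisms of [Kbar] over [K]. *)
Lemma node_act_embeds (Mx : (node F x -> node F x) -> Prop) :
  (forall (sigma : node F x -> node F x) (tau : {rmorphism Kbar -> Kbar}),
     (forall a, tau (iota a) = iota a) ->
     (forall u, level (sigma u) = level u) ->
     (forall u, point (sigma u) = omap tau (point u)) -> Mx sigma) ->
  equivariantly_embeds iota Mx.
Proof.
move=> MxP; exists node_act; split.
- move=> s /gal_extend[tau tauK tauE].
  by apply: (MxP _ tau tauK) => u; have [] := node_actE tauK tauE u.
- by move=> s u /gal_extend[tau tauK tauE]; have [-> -> ->] := node_actE tauK tauE u.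
- move=> s s' Gs Gs' u.
  have [tau tauK tauE] := gal_extend Gs; have [tau' tauK' tauE'] := gal_extend Gs'.
  have ttK a : (tau \o tau') (iota a) = iota a by rewrite /= tauK' tauK.
  have ttE a : Kinf a -> (tau \o tau') a = (s \o s') a.
    by move=> Ka; rewrite /= (tauE' _ Ka) tauE //; case: Gs' => + _ _ _ _; apply.
  have [l1 p1 _] := node_actE (tau := tau \o tau') ttK ttE u.
  have [l2 p2 _] := node_actE tauK' tauE' u.
  have [l3 p3 _] := node_actE tauK tauE (node_act s' u).
  apply: node_inj; rewrite ?l1 /= ?l3 ?l2 // p1 p3 p2.
  by case: (point u).
- move=> s s' Gs Gs' ss' a [m Ka].
  have [tau tauK tauE] := gal_extend Gs; have [tau' tauK' tauE'] := gal_extend Gs'.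
  rewrite -tauE; last by exists m.
  rewrite -tauE'; last by exists m.
  (* The elements on which [tau] and [tau'] agree form a subfield; it contains the generators
     because the two actions agree on level [m]. *)
  apply: (Ka (fun a => tau a = tau' a)).
  + split; first by rewrite !rmorph1.
      by move=> b b' hb hb'; rewrite !rmorphB hb hb'.
    by move=> b b' hb hb'; rewrite !fmorph_div hb hb'.
  + by move=> b; rewrite tauK tauK'.
  + move=> b /eqP bx; pose u : node F x :=
      exist (fun u : nat * P1 Kbar => iter u.1 F u.2 == x) (m, Some b) bx.
    have [_ p1 _] := node_actE tauK tauE u; have [_ p2 _] := node_actE tauK' tauE' u.
    by move: p2; rewrite -ss' p1 => -[].
Qed.

(** A single labeling serves both parts of the theorem, since the common sign is known explicitly
    from the action of [tau] on [xi1]. *)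
Lemma exists_Mtilde_labeling : exists lab : node F x -> seq bool,
  is_labeling lab /\
  forall (sigma : node F x -> node F x) (tau : {rmorphism Kbar -> Kbar}),
     (forall a, tau (iota a) = iota a) ->
     (forall u, level (sigma u) = level u) ->
     (forall u, point (sigma u) = omap tau (point u)) ->
     is_tree_aut sigma /\
     forall y, is_sgn lab k.+1 sigma y ((-1) ^+ (omap tau xi1 != xi1)).
Proof.
have [c cP cg] := exists_signed_section.
exists (node_label c); split; first exact: node_label_labeling.
move=> sigma tau tauK sl sp; split; first exact: (sigma_tree_aut tauK sl sp).
exact: (sigma_sgn tauK sl sp cP cg).
Qed.

(** * Discriminant and rationality of the critical point *)

Lemma critical_poly : exists w : {poly K},
  [/\ w != 0, (size w <= 3)%N
    & forall a, xi1 = Some a -> root (map_poly iota w) a].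
Proof.
pose n0 := (num f)`_0; pose n1 := (num f)`_1; pose n2 := (num f)`_2.
pose d0 := (den f)`_0; pose d1 := (den f)`_1; pose d2 := (den f)`_2.
(* The coefficients of the Wronskian of [num f] and [den f], whose cubic terms cancel. *)
pose s := [:: n0 * d1 - n1 * d0; 2%:R * (n0 * d2 - n2 * d0); n1 * d2 - n2 * d1].
pose w := \poly_(i < 3) s`_i.
have sw : (size w <= 3)%N by exact: size_poly.
have wE a : (map_poly iota w).[a] =
    wedge (qmap n d (a, 1)) (qpolar n d (a, 1) (1, 0)).
  rewrite horner_size3 ?size_map_poly // !coef_map !coef_poly /=.
  rewrite /wedge /qmap /qpolar /qform /polar /= !coef_map.
  by rewrite !(rmorphB, rmorphM) /= rmorph_nat; ring.
exists w; split=> // [|a xiE]; last first.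
  by rewrite /root wE; apply/eqP; have := qcrit1; rewrite xiE; apply.
apply/negP => /eqP w0.
(* If the Wronskian were zero, every finite point would be critical, but 0, 1 and -1 are three
   distinct points. *)
have cr a : Some a = xi1 \/ Some a = xi2.
  apply: (qcrit_lift two_neq0 liftF qcrit1 qcrit2 F_xi_neq).
  have c1 : wedge (qmap n d (a, 1)) (qpolar n d (a, 1) (1, 0)) = 0.
    by rewrite -wE w0 rmorph0 horner0.
  apply: qcrit_basis => //.
  rewrite -[RHS](mulr0 (- a)) -[in RHS]c1 /wedge /qmap /qpolar /qform /polar /=.
  by ring.
have uq : uniq [:: Some 0; Some 1; Some (-1) : P1 Kbar].
  rewrite /= !inE !(inj_eq Some_inj) !(eq_sym 0) oppr_eq0 oner_eq0 /=.
  by rewrite -addr_eq0 two_neq0.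
have sub a : Some a \in [:: xi1; xi2].
  by rewrite !inE; have [->|->] := cr a; rewrite eqxx ?orbT.
suff /(uniq_leq_size uq) :
  {subset [:: Some 0; Some 1; Some (-1)] <= [:: xi1; xi2]} by [].
by move=> z; rewrite in_cons in_cons mem_seq1 => /or3P[] /eqP ->; apply: sub.
Qed.

(** By [critical_poly] the minimal polynomial has degree at most 2, and degree 1 would make [xi1]
    rational; hence [m = (X - a)(X - b)], with [a + b] read off from its linear coefficient. *)
Lemma min_poly_conjugate (a : Kbar) (m : {poly K}) (delta : K) :
  xi1 = Some a -> ~ (exists y : P1 K, xi1 = omap iota y) ->
  is_min_poly iota a m -> is_discriminant iota m delta ->
  exists b, [/\ root (map_poly iota m) b, iota delta = (a - b) ^+ 2
              & exists c, a + b = iota c].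
Proof.
move=> xiE irr [monm ma minm] [rs mE dE].
have [w [wN0 sw wa]] := critical_poly.
have sm3 : (size m <= 3)%N := leq_trans (dvdp_leq wN0 (minm w (wa a xiE))) sw.
have srs : size m = (size rs).+1.
  by rewrite -(size_map_poly iota) mE size_prod_XsubC.
have mars : a \in rs by move: ma; rewrite mE root_prod_XsubC.
have coefE i : iota m`_i = (\prod_(r <- rs) ('X - r%:P))`_i.
  by rewrite -mE coef_map.
rewrite srs in sm3; case: rs => [|r1 [|r2 [|//]]] //= in mE dE srs mars coefE sm3 *.
  case: irr; exists (Some (- m`_0)); rewrite xiE /=; congr Some.
  move: mars; rewrite inE => /eqP ->.
  by rewrite rmorphN coefE big_seq1 coefB coefX coefC /= sub0r opprK.
have sumE : r1 + r2 = iota (- m`_1).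
  rewrite rmorphN coefE big_cons big_seq1 mulrBl !mulrBr.
  rewrite !coefB -expr2 coefXn coefXM coefMX !coefC coefCM coefC /= mulr0.
  by ring.
have mr r : root (map_poly iota m) r = (r == r1) || (r == r2).
  by rewrite mE root_prod_XsubC !inE.
have {}dE : iota delta = (r1 - r2) ^+ 2.
  by rewrite dE !(big_ord_recr, big_ord0) /= !mul1r.
move: mars; rewrite !inE => /orP[] /eqP ->.
  by exists r2; split; rewrite ?mr ?eqxx ?orbT //; exists (- m`_1).
exists r1; split; rewrite ?mr ?eqxx //; first by rewrite dE; ring.
by exists (- m`_1); rewrite addrC.
Qed.

(** If [(a - b)^2] is a square in [K], then [a - b] lies in [K], as does [a + b], and halving their
    sum gives [a]. *)
Lemma square_discriminant_rational delta :
  is_pt_discriminant iota xi1 delta ->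
  (exists c, delta = c ^+ 2) <-> exists y : P1 K, xi1 = omap iota y.
Proof.
move=> [[rat ->]|[irr [a [m [xiE minm disc]]]]].
  by split=> // _; exists 1; rewrite expr1n.
split=> // -[c dE].
have [b [_ abE [s sE]]] := min_poly_conjugate xiE irr minm disc.
have half e : a - b = iota e -> a = iota ((s + e) / 2%:R).
  move=> eE; rewrite fmorph_div rmorphD -sE -eE rmorph_nat.
  by apply: (mulIf two_neq0); rewrite divfK ?two_neq0 //; ring.
move/eqP: abE; rewrite dE rmorphXn eq_sym eqf_sqr -rmorphN.
case/orP => /eqP/half aE.
  by exists (Some ((s + c) / 2%:R)); rewrite xiE {1}aE.
by exists (Some ((s - c) / 2%:R)); rewrite xiE {1}aE.
Qed.

(** A nonzero discriminant makes the conjugate [b] distinct from [a]; the homomorphism from [K[a]]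
    sending [a] to [b] extends to [Kbar]. *)
Lemma exists_moving_xi1 delta : delta != 0 ->
  is_pt_discriminant iota xi1 delta -> ~ (exists y : P1 K, xi1 = omap iota y) ->
  exists2 tau : {rmorphism Kbar -> Kbar},
    forall a, tau (iota a) = iota a & omap tau xi1 != xi1.
Proof.
move=> dN0 [[rat _ //]|[_ [a [m [xiE minm disc]]]]] irr.
have [b [mb abE _]] := min_poly_conjugate xiE irr minm disc.
have aNb : b != a.
  apply: contraNneq dN0 => ba; move/eqP: abE.
  by rewrite ba subrr expr0n /= fmorph_eq0.
pose ev (p : {poly K}) := ((map_poly iota p).[a], (map_poly iota p).[b]).
have Ghom : hom_graph iota (range ev).
  split.
  - by move=> c; exists c%:P; rewrite // /ev map_polyC !hornerC.
  - by move=> _ _ [p _ <-] [q _ <-]; exists (p - q); rewrite // /ev rmorphB !hornerE.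
  - by move=> _ _ [p _ <-] [q _ <-]; exists (p * q); rewrite // /ev rmorphM !hornerE.
  - move=> z [p _ [/eqP pa <-]]; have [_ _ /(_ p pa)/dvdpP[q ->]] := minm.
    by rewrite rmorphM hornerM (rootP mb) mulr0.
have [tau tauG] := hom_graph_rmorphism algKbar Ghom; exists tau.
  move=> c; apply: (tauG (iota c, iota c)); exists c%:P => //.
  by rewrite /ev map_polyC !hornerC.
rewrite xiE /= (inj_eq Some_inj) (tauG (a, b)) //.
by exists 'X => //; rewrite /ev map_polyX !hornerX.
Qed.

End Collision.

Theorem theorem1p2
  (K : fieldType) (charK : 2%N \notin [pchar K])
  (* Kbar, with iota, is an algebraic closure of K *)
  (Kbar : closedFieldType) (iota : {rmorphism K -> Kbar})
  (algKbar : forall a : Kbar, algebraicOver iota a)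
  (f : ratfun K) (degf : degree f = 2%N)
  (xi1 xi2 : P1 Kbar)
  (critf : forall z : P1 Kbar,
     is_critical (map_ratfun iota f) z <-> z = xi1 \/ z = xi2)
  (delta : K) (delta_neq0 : delta != 0)
  (deltaE : is_pt_discriminant iota xi1 delta)
  (x0 : P1 K)
  (x0_noncrit : forall (n : nat) (z : P1 Kbar),
     is_critical (map_ratfun iota f) z ->
     iter n (rat_eval (map_ratfun iota f)) z <> omap iota x0)
  (l : nat) (l_ge2 : (2 <= l)%N)
  (collide : iter l (rat_eval (map_ratfun iota f)) xi1 =
             iter l (rat_eval (map_ratfun iota f)) xi2)
  (not_collide : iter l.-1 (rat_eval (map_ratfun iota f)) xi1 <>
                 iter l.-1 (rat_eval (map_ratfun iota f)) xi2) :
  let F := rat_eval (map_ratfun iota f) in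
  let x := omap iota x0 in
  (exists lab : node F x -> seq bool,
     is_labeling lab /\ equivariantly_embeds iota (Mtilde lab l)) /\
  ((exists lab : node F x -> seq bool,
      is_labeling lab /\ equivariantly_embeds iota (M lab l)) <->
   exists c : K, delta = c ^+ 2).
Proof.
move=> F x.
case: l l_ge2 collide not_collide => // k k_gt0 collide /eqP not_collide.
have crit1 : is_critical (map_ratfun iota f) xi1 by apply/critf; left.
have crit2 : is_critical (map_ratfun iota f) xi2 by apply/critf; right.
have orbit1 m := x0_noncrit m _ crit1; have orbit2 m := x0_noncrit m _ crit2.
have [lab [labP labM]] := exists_Mtilde_labeling charK algKbar degf crit1 crit2
  orbit1 orbit2 k_gt0 collide not_collide.
have ratP := square_discriminant_rational charK degf crit1 crit2
  k_gt0 not_collide deltaE.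
split; [|split].
- exists lab; split=> //.
  apply: (node_act_embeds algKbar degf crit1 crit2 k_gt0 not_collide).
  move=> sigma tau tauK sl sp; have [saut sgn] := labM sigma tau tauK sl sp.
  by split=> //; exists ((-1) ^+ (omap tau xi1 != xi1)).
- move=> [lab' [lab'P [phi [phiM phiE _ _]]]]; apply/ratP.
  (* For irrational [xi1], some [tau] moves it. By equivariance [phi tau] is the action of [tau],
     whose root sign is -1 for [lab], whereas membership in [M lab'] makes it 1; the sign at the
     root does not depend on the labeling. *)
  apply: contrapT => irr.
  have [tau tauK tau_xi] := exists_moving_xi1 charK algKbar degf crit1 crit2
    k_gt0 not_collide delta_neq0 deltaE irr.
  have Gtau := rmorphism_gal x0 algKbar degf tauK.
  have sl u : level (phi tau u) = level u by have [] := phiE tau u Gtau.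
  have sp u : point (phi tau u) = omap tau (point u) by have [] := phiE tau u Gtau.
  have [_ sgn] := labM _ tau tauK sl sp; have [_ sgn'] := phiM _ Gtau.
  by have := is_sgn_root_uniq labP lab'P sl (sgn _) sgn'; rewrite tau_xi.
- move/ratP => [y xiE]; exists lab; split=> //.
  apply: (node_act_embeds algKbar degf crit1 crit2 k_gt0 not_collide).
  move=> sigma tau tauK sl sp; have [saut sgn] := labM sigma tau tauK sl sp.
  (* A rational [xi1] is fixed by every [tau], so all signs for [lab] equal 1. *)
  have tau_xi : omap tau xi1 = xi1 by rewrite xiE; case: (y) => //= a; rewrite tauK.
  rewrite tau_xi eqxx in sgn.
  by split; [split=> //; exists 1 => // z|]; apply: sgn.
Qed.
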